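(* Assume that $p>0$. Let $\{a_{j}\}_{j\in\mathbb{N}}$ be a sequence of real numbers such that $l_{0}:=\sup_{j\in\mathbb{N}}|a_{j}|^{1/j}<\infty$. Then $$f(x):=x\Big(1+\sum_{j=1}^{\infty}a_{j}x^{j}\Big)^{1/p}$$ can be defined for $|x|<R_{0}:=(2l_{0})^{-1}$, where $R_{0}=\infty$ if $l_{0}=0$, and there exist a connected open neighborhood $U$ of the origin in $\mathbb{R}$ such that $U\subset(-R_{0},R_{0})$ and a diffeomorphism $x=\Phi(y)$ of class $C^{\infty}$ for $x,y\in U$ such that $f(x)=y$, $\Phi(U\cap[0,\infty))=U\cap[0,\infty)$ and $\Phi(U\cap(-\infty,0])=U\cap(-\infty,0]$, and for any $a\in C^{\infty}_{0}(\mathbb{R})$ such that $\mathrm{supp}\,a\subset U$, the following hold. (i) For any $N\in\mathbb{N}$, $$\int_{0}^{\infty}e^{\pm i\lambda x^{p}\left(1+\sum_{j=1}^{\infty}a_{j}x^{j}\right)}a(x)\,dx=\sum_{k=0}^{N-1}\frac{\tilde{I}_{p,k+1}^{\pm}}{k!}\left(\frac{d}{dy}\right)^{k}\bigg|_{y=0}\left\{a(\Phi(y))\frac{d\Phi}{dy}(y)\right\}\lambda^{-\frac{k+1}{p}}+O\Big(\lambda^{-\frac{N+1-(p-[p])}{p}}\Big)$$ as $\lambda\to\infty$. (ii) If $p=m\in\mathbb{N}$, then for any $N\in\mathbb{N}$, $$\int_{-\infty}^{\infty}e^{\pm i\lambda x^{m}\left(1+\sum_{j=1}^{\infty}a_{j}x^{j}\right)}a(x)\,dx=\sum_{k=0}^{N-1}\frac{c_{m,k}^{\pm-}}{k!}\left(\frac{d}{dy}\right)^{k}\bigg|_{y=0}\left\{a(\Phi(y))\frac{d\Phi}{dy}(y)\right\}\lambda^{-\frac{k+1}{m}}+O\Big(\lambda^{-\frac{N+1}{m}}\Big)$$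 as $\lambda\to\infty$, with $$c_{m,k}^{\pm-}:=\tilde{I}_{m,k+1}^{\pm}-(-1)^{k}\tilde{I}_{m,k+1}^{\pm\pm^{m}}.$$
   Context: $\mathbb{N}$ is the set of positive integers; $[x]$ is the greatest integer $\leq x$; the double signs $\pm$ are in the same order; $\pm^{m}$ stands for the sign of $(-1)^{m}$; $C^\infty_0(\mathbb{R})$ is the set of compactly supported complex-valued $C^\infty$ functions on $\mathbb{R}$; $\lambda>0$. For $p>0$, $k\in\mathbb{Z}_{\geq 0}$ and $m\in\mathbb{N}$, $$\tilde{I}_{p,k+1}^{\pm}:=Os\text{-}\int_{0}^{\infty}e^{\pm ix^{p}}x^{k}\,dx=p^{-1}e^{\pm i\frac{\pi}{2}\frac{k+1}{p}}\Gamma\left(\frac{k+1}{p}\right),$$ $$\tilde{I}_{m,k+1}^{\pm\pm^{m}}:=Os\text{-}\int_{0}^{\infty}e^{\pm(-1)^{m}iy^{m}}y^{k}\,dy=m^{-1}e^{\pm(-1)^{m}i\frac{\pi}{2}\frac{k+1}{m}}\Gamma\left(\frac{k+1}{m}\right),$$ where $\Gamma$ is the Gamma function and $Os\text{-}\int_0^\infty g(x)\,dx:=\lim_{\varepsilon\to+0}\int_0^\infty g(x)\chi(\varepsilon x)\,dx$, the limit being independent of the Schwartz function $\chi$ on $\mathbb{R}$ with $\chi(0)=1$.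
   Formalization: The sign in c_{m,k} is corrected to Ĩ^±_{m,k+1} + (-1)^k Ĩ^{±±^m}_{m,k+1} (the printed minus fails for m=2, k=0), and Φ maps a neighborhood V of 0 in y onto U in x, both in (-R_0,R_0), since a single U for x and y is impossible for f(x)=x+x^2. *)

(* Defs.v *)
From Stdlib Require Import Reals Rtopology Factorial.
From Coquelicot Require Import Coquelicot.

Open Scope R_scope.

(* x^p for x >= 0 and p > 0.  [Rpower] cannot be used directly at the origin:
   Stdlib has [ln 0 = 0], hence [Rpower 0 p = 1]. *)
Definition rpow (x p : R) : R :=
  if Rlt_dec 0 x then Rpower x p else 0.

(* e^{i theta} for real theta *)
Definition expi (theta : R) : C := (cos theta, sin theta).

Definition smooth_on (U : R -> Prop) (f : R -> R) : Prop :=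
  forall (n : nat) (x : R), U x -> ex_derive_n f n x.

Definition Csmooth (g : R -> C) : Prop :=
  forall (n : nat) (x : R),
    ex_derive_n (fun t => Re (g t)) n x /\ ex_derive_n (fun t => Im (g t)) n x.

Definition CDerive_n (g : R -> C) (n : nat) (x : R) : C :=
  (Derive_n (fun t => Re (g t)) n x, Derive_n (fun t => Im (g t)) n x).

Definition supp (g : R -> C) : R -> Prop := adherence (fun x => g x <> 0%C).

Definition test_function (g : R -> C) : Prop := Csmooth g /\ compact (supp g).

Definition schwartz (chi : R -> C) : Prop :=
  Csmooth chi /\
  forall j n : nat, exists M : R, forall x : R,
    Rabs x ^ j * Cmod (CDerive_n chi n x) <= M.

Definition CInt_half (g : R -> C) : C :=
  RInt_gen (V := C_R_CompleteNormedModule) g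
    (at_point 0) (Rbar_locally p_infty).

Definition CInt_line (g : R -> C) : C :=
  RInt_gen (V := C_R_CompleteNormedModule) g
    (Rbar_locally m_infty) (Rbar_locally p_infty).

(* [l] is the limit of the regularized integrals, whatever the regularizing
   Schwartz function. *)
Definition is_Os_int (g : R -> C) (l : C) : Prop :=
  forall chi : R -> C, schwartz chi -> chi 0 = 1%C ->
    filterlim (fun eps : R => CInt_half (fun x => (g x * chi (eps * x)%R)%C))
      (at_right 0) (locally l).

Definition Os_int (g : R -> C) : C :=
  iota (T := C_R_CompleteNormedModule) (is_Os_int g).

(* Itilde s p k is Os-int_0^oo e^{s i x^p} x^k dx with s = 1 or s = -1; its
   conventional index is (p, k+1), shifted by one from the exponent k. *)
Definition Itilde (s p : R) (k : nat) : C :=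
  Os_int (fun x => (expi (s * rpow x p) * RtoC (x ^ k))%C).

(* The contribution of the negative half-line comes from y |-> -y, which turns
   e^{s i y^m} y^k dy into (-1)^k e^{s (-1)^m i y^m} y^k dy on (0, oo), with no
   change of overall sign: the two half-line contributions are added.  (With
   m = 2, k = 0 their difference would be 0, whereas the leading coefficient of
   the Fresnel integral is sqrt PI * e^{s i PI/4}.) *)
Definition coef_line (s : R) (m k : nat) : C :=
  (Itilde s (INR m) k
   + RtoC ((-1) ^ k) * Itilde (s * (-1) ^ m) (INR m) k)%C.

(* The coefficient sequence is indexed from 1; [a 0] is never used. *)
Definition one_plus_series (a : nat -> R) (x : R) : R :=
  1 + Series (fun j => a (S j) * x ^ S j).

Definition root_set (a : nat -> R) (r : R) : Prop :=
  exists j : nat, (1 <= j)%nat /\ r = rpow (Rabs (a j)) (/ INR j).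

Definition radius (l0 : R) : Rbar :=
  if Req_EM_T l0 0 then p_infty else Finite (/ (2 * l0)).

Definition in_radius (l0 x : R) : Prop := Rbar_lt (Finite (Rabs x)) (radius l0).

(* The second factor is meaningful where [one_plus_series a x] is positive. *)
Definition phase_root (p : R) (a : nat -> R) (x : R) : R :=
  x * rpow (one_plus_series a x) (/ p).

Definition connected_open_nbhd0 (U : R -> Prop) : Prop :=
  is_connected U /\ open_set U /\ U 0.

Definition diffeomorphism (V U : R -> Prop) (Phi : R -> R) : Prop :=
  smooth_on V Phi /\ (forall y, V y -> U (Phi y)) /\
  exists Psi : R -> R,
    smooth_on U Psi /\ (forall x, U x -> V (Psi x)) /\
    (forall y, V y -> Psi (Phi y) = y) /\ (forall x, U x -> Phi (Psi x) = x).

Definition maps_onto (Phi : R -> R) (A B : R -> Prop) : Prop :=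
  forall x, B x <-> exists y, A y /\ Phi y = x.

Definition bigO_infty (F : R -> C) (g : R -> R) : Prop :=
  exists M : R,
    Rbar_locally p_infty (fun lam => Cmod (F lam) <= M * Rabs (g lam)).

(* (d/dy)^k at y = 0 of a(Phi(y)) Phi'(y) *)
Definition amp_deriv0 (u : R -> C) (Phi : R -> R) (k : nat) : C :=
  CDerive_n (fun y => (u (Phi y) * RtoC (Derive Phi y))%C) k 0.

(* Main.v *)
(* Put y = f(x) = x (1 + sum a_j x^j)^(1/p).  This turns the phase into y^p and
   the amplitude into b(y) = a(Phi(y)) Phi'(y), so everything reduces to the
   expansion of E_w(lam) = int_0^oo cos(lam y^p + phi) w(y) dy.

   If w vanishes at 0 to order J p and decays at infinity, J integrations by
   parts give E_w(lam) = O(lam^(-J)).  Let chi be a cut-off equal to 1 to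
   infinite order at 0 and let w_k = y^k chi.  Since
   (lam d/dlam + (k+1)/p) E_(w_k) = - E_v / p with v = y^(k+1) chi' flat at 0,
   lam^((k+1)/p) E_(w_k)(lam) converges, faster than any power of lam, to a
   constant I_k.  A general w differs from a combination of the w_k, with
   coefficients its Taylor coefficients at 0, by a function vanishing to high
   order at 0; this gives the expansion with error O(lam^(-(N+1)/p)), for every
   real p > 0.

   The case w = y^k chi with chi a Schwartz function and lam = eps^(-p) is, after
   dilation, the regularized integral defining Itilde, which is therefore given
   by the constants I_k; Gamma-function values are never needed. *)
Require Import Defs.
From Stdlib Require Import Reals Rtopology Factorial.
From Coquelicot Require Import Coquelicot.
From Stdlib Require Import Lra Lia ClassicalEpsilon Ranalysis5.
Open Scope R_scope.

Set Bullet Behavior "Strict Subproofs".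

(** * Integrals over the positive half-line *)

(** For real p > 0 the phase y^p need not be smooth at 0, and [Rpower] takes a wrong value there;
    the analysis therefore stays on the open half-line, with integrals taken as limits at both ends.
    Amplitudes are measured by two exponents: |w| <= C y^b governs 0, |w| <= C y^a governs infinity,
    and each derivative loses one power in both. An integration by parts replaces w by (y^(1-p) w)'
    and lowers both exponents by p: this improves the decay at infinity, while at 0 an order b >= J
    p pays for J steps. As long as a <= -2 and b >= 0, all integrals converge absolutely under the
    single majorant D / (1 + y^2), whose primitive is D atan y. The cut-off is the explicit function
    exp(-y exp(-1/y)) instead of a compactly supported bump: its estimates follow by the product
    rule from those of powers and of exp(-1/y). Complex integrals are split into real ones with a
    phase shift, phi = 0 for the cosine and phi = -PI/2 for the sine. *)

Definition is_int_pos (g : R -> R) (l : R) : Prop :=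
  is_RInt_gen g (at_right 0) (Rbar_locally p_infty) l.

Lemma prod_pos (P : R -> Prop) :
  (forall y, 0 < y -> P y) ->
  filter_prod (at_right 0) (Rbar_locally p_infty)
    (fun ab : R * R => forall x, Rmin (fst ab) (snd ab) <= x <= Rmax (fst ab) (snd ab) -> P x).
Proof.
  intros H.
  apply Filter_prod with (fun a => 0 < a) (fun b => 0 < b).
  - exists (mkposreal 1 Rlt_0_1); intros y _ Hy; exact Hy.
  - exists 0; intros y Hy; exact Hy.
  - intros a b Ha Hb x [Hx _]; apply H; cbn in Hx.
    apply Rlt_le_trans with (2 := Hx). now apply Rmin_glb_lt.
Qed.

Lemma is_int_pos_ext f g l :
  (forall y, 0 < y -> f y = g y) -> is_int_pos f l -> is_int_pos g l.
Proof.
  intros H. apply (is_RInt_gen_ext (V := R_NormedModule) f g l).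
  generalize (prod_pos _ H). apply filter_imp. intros [a b] K x Hx. apply K. lra.
Qed.

Lemma is_int_pos_unique f l l' : is_int_pos f l -> is_int_pos f l' -> l = l'.
Proof.
  intros H H'.
  now rewrite <- (is_RInt_gen_unique (V := R_CompleteNormedModule) f l H),
    <- (is_RInt_gen_unique (V := R_CompleteNormedModule) f l' H').
Qed.

Lemma is_int_pos_plus f g l l' :
  is_int_pos f l -> is_int_pos g l' -> is_int_pos (fun y => f y + g y) (l + l').
Proof. apply (is_RInt_gen_plus (V := R_NormedModule) f g l l'). Qed.

Lemma is_int_pos_scal f c l :
  is_int_pos f l -> is_int_pos (fun y => c * f y) (c * l).
Proof. apply (is_RInt_gen_scal (V := R_NormedModule) f c l). Qed.

Lemma locally_pos (P : R -> Prop) y : 0 < y -> (forall z, 0 < z -> P z) -> locally y P.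
Proof.
  intros Hy H. exists (mkposreal y Hy). intros z Hz. apply H.
  apply Rabs_def2 in Hz; cbn in Hz; unfold minus, plus, opp in Hz; cbn in Hz; lra.
Qed.

Lemma is_int_pos_derive (G g : R -> R) (l0 l1 : R) :
  (forall y, 0 < y -> is_derive G y (g y)) ->
  (forall y, 0 < y -> continuous g y) ->
  filterlim G (at_right 0) (locally l0) -> is_lim G p_infty l1 ->
  is_int_pos g (l1 - l0).
Proof.
  intros HG Hg H0 H1.
  apply is_int_pos_ext with (Derive G).
  { intros y Hy. now apply is_derive_unique, HG. }
  apply (is_RInt_gen_Derive G l0 l1); trivial.
  - apply prod_pos. intros y Hy. eexists; now apply HG.
  - apply prod_pos. intros y Hy.
    apply continuous_ext_loc with g; [|now apply Hg].
    apply locally_pos; trivial. intros z Hz. symmetry. now apply is_derive_unique, HG.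
Qed.

Lemma continuous_ex_RInt_pos (g : R -> R) a b :
  (forall y, 0 < y -> continuous g y) -> 0 < a -> 0 < b -> ex_RInt g a b.
Proof.
  intros Hg Ha Hb. apply (ex_RInt_continuous (V := R_CompleteNormedModule)).
  intros z [Hz _]. apply Hg. apply Rlt_le_trans with (2 := Hz). now apply Rmin_glb_lt.
Qed.

Lemma is_derive_atan_scal D y : is_derive (fun z => D * atan z) y (D / (1 + y ^ 2)).
Proof. auto_derive; trivial. field. nra. Qed.

Lemma continuous_cauchy_density D y : continuous (fun z => D / (1 + z ^ 2)) y.
Proof.
  apply (ex_derive_continuous (V := R_NormedModule)). auto_derive. nra.
Qed.

(** Comparison with an explicit primitive: [D * atan] has limits at both ends of the half-line, so
    its increments supply the Cauchy criterion for the improper integral. *)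
Lemma RInt_dominated_atan (g : R -> R) D a b :
  (forall y, 0 < y -> continuous g y) ->
  (forall y, 0 < y -> Rabs (g y) <= D / (1 + y ^ 2)) ->
  0 < a -> 0 < b -> Rabs (RInt g a b) <= Rabs (D * atan b - D * atan a).
Proof.
  intros Hc Hd.
  assert (W : forall a b, 0 < a -> a <= b -> Rabs (RInt g a b) <= D * atan b - D * atan a).
  { intros x y Hx Hxy.
    apply (norm_RInt_le (V := R_NormedModule) g (fun y => D / (1 + y ^ 2)) x y).
    - exact Hxy.
    - intros z Hz. apply Hd. lra.
    - apply (RInt_correct (V := R_CompleteNormedModule)).
      apply continuous_ex_RInt_pos; trivial; lra.
    - apply (is_RInt_derive (V := R_CompleteNormedModule) (fun z => D * atan z)); intros z _.
      + apply is_derive_atan_scal.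
      + apply continuous_cauchy_density. }
  intros Ha Hb. destruct (Rle_dec a b) as [h|h].
  - apply Rle_trans with (1 := W a b Ha h), Rle_abs.
  - rewrite <- (opp_RInt_swap (V := R_CompleteNormedModule)).
    2: now apply continuous_ex_RInt_pos.
    change (Rabs (- RInt g b a) <= Rabs (D * atan b - D * atan a)).
    rewrite Rabs_Ropp, (Rabs_minus_sym (D * atan b)).
    apply Rle_trans with (2 := Rle_abs _), W; lra.
Qed.

Lemma is_lim_atan_scal D : is_lim (fun z => D * atan z) p_infty (D * (PI / 2)).
Proof.
  apply (is_lim_scal_l atan D p_infty (PI / 2)).
  apply is_lim_ext_loc with (fun x => PI / 2 - atan (/ x)).
  { exists 0. intros x Hx. rewrite atan_inv by trivial. ring. }
  replace (PI / 2) with (PI / 2 - atan 0) at 1 by (rewrite atan_0; ring).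
  apply is_lim_minus'.
  - apply is_lim_const.
  - apply (is_lim_comp_continuous Rinv atan p_infty 0).
    + apply (is_lim_inv (fun x => x) p_infty p_infty (is_lim_id _)); easy.
    + apply (ex_derive_continuous (V := R_NormedModule)). auto_derive. trivial.
Qed.

Lemma filterlim_atan_scal_0 D : filterlim (fun z => D * atan z) (at_right 0) (locally 0).
Proof.
  eapply filterlim_filter_le_1.
  { apply filter_le_within. }
  assert (H : continuous (fun z => D * atan z) 0).
  { apply (ex_derive_continuous (V := R_NormedModule)). auto_derive. trivial. }
  unfold continuous in H. now rewrite atan_0, Rmult_0_r in H.
Qed.

Lemma is_int_pos_cauchy_density D :
  is_int_pos (fun y => D / (1 + y ^ 2)) (D * (PI / 2)).
Proof.
  replace (D * (PI / 2)) with (D * (PI / 2) - 0) by ring.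
  apply is_int_pos_derive with (fun z => D * atan z).
  - intros; apply is_derive_atan_scal.
  - intros; apply continuous_cauchy_density.
  - apply filterlim_atan_scal_0.
  - apply is_lim_atan_scal.
Qed.

Lemma is_int_pos_bound g l D :
  (forall y, 0 < y -> Rabs (g y) <= D / (1 + y ^ 2)) ->
  is_int_pos g l -> Rabs l <= 2 * Rabs D.
Proof.
  intros Hd Hl.
  assert (Rabs l <= D * (PI / 2)).
  { apply (RInt_gen_norm (V := R_CompleteNormedModule) (Fa := at_right 0)
      (Fb := Rbar_locally p_infty) g (fun y => D / (1 + y ^ 2)) l).
    - apply Filter_prod with (fun a => a < 1) (fun b => 1 < b).
      + exists (mkposreal 1 Rlt_0_1); intros y Hy _.
        apply Rabs_def2 in Hy; cbn in Hy; unfold minus, plus, opp in Hy; cbn in Hy; lra.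
      + exists 1; intros y Hy; exact Hy.
      + cbn; intros; lra.
    - apply Filter_prod with (fun a => 0 < a) (fun b => True).
      + exists (mkposreal 1 Rlt_0_1); intros y _ Hy; exact Hy.
      + exists 1; trivial.
      + cbn; intros a b Ha _ x Hx. apply Hd; lra.
    - exact Hl.
    - apply is_int_pos_cauchy_density. }
  assert (0 <= D).
  { generalize (Hd 1 Rlt_0_1) (Rabs_pos (g 1)). lra. }
  rewrite (Rabs_pos_eq D) by trivial.
  (* The factor 2 comes from [PI <= 4], that is PI / 2 <= 2. *)
  generalize PI_4; nra.
Qed.

Lemma ex_int_pos_dominated (g : R -> R) D :
  (forall y, 0 < y -> continuous g y) ->
  (forall y, 0 < y -> Rabs (g y) <= D / (1 + y ^ 2)) ->
  exists l, is_int_pos g l.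
Proof.
  intros Hc Hd.
  assert (E : exists l, filterlim (fun ab : R * R => RInt g (fst ab) (snd ab))
    (filter_prod (at_right 0) (Rbar_locally p_infty)) (locally l)).
  { apply (filterlim_locally_cauchy (U := R_CompleteSpace)).
    intros eps.
    assert (He : 0 < eps / 4) by (generalize (cond_pos eps); lra).
    exists (fun ab : R * R => (0 < fst ab /\ ball 0 (eps / 4) (D * atan (fst ab))) /\
      (0 < snd ab /\ ball (D * (PI / 2)) (eps / 4) (D * atan (snd ab)))).
    split.
    - apply Filter_prod with
        (fun a => 0 < a /\ ball 0 (eps / 4) (D * atan a))
        (fun b => 0 < b /\ ball (D * (PI / 2)) (eps / 4) (D * atan b)).
      + apply filter_and.
        * exists (mkposreal 1 Rlt_0_1); intros y _ Hy; exact Hy.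
        * apply (filterlim_atan_scal_0 D). now exists (mkposreal _ He).
      + apply filter_and.
        * exists 0; intros y Hy; exact Hy.
        * apply (is_lim_atan_scal D). now exists (mkposreal _ He).
      + tauto.
    - intros [a b] [a' b'] [[Ha Ha1] [Hb Hb1]] [[Ha' Ha1'] [Hb' Hb1']].
      cbn [fst snd] in *.
      change (Rabs (D * atan a - 0) < eps / 4) in Ha1.
      change (Rabs (D * atan a' - 0) < eps / 4) in Ha1'.
      change (Rabs (D * atan b - D * (PI / 2)) < eps / 4) in Hb1.
      change (Rabs (D * atan b' - D * (PI / 2)) < eps / 4) in Hb1'.
      change (Rabs (RInt g a' b' - RInt g a b) < eps).
      assert (X := RInt_dominated_atan g D a' a Hc Hd Ha' Ha).
      assert (Y := RInt_dominated_atan g D b b' Hc Hd Hb Hb').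
      (* The two integrals differ by two end pieces, each bounded by an increment of [D * atan]
         smaller than eps / 2. *)
      assert (R1 : RInt g a' b' = RInt g a' a + RInt g a b + RInt g b b').
      { rewrite <- (RInt_Chasles (V := R_CompleteNormedModule) g a' b b'),
          <- (RInt_Chasles (V := R_CompleteNormedModule) g a' a b); trivial;
          now apply continuous_ex_RInt_pos. }
      rewrite R1.
      replace (RInt g a' a + RInt g a b + RInt g b b' - RInt g a b)
        with (RInt g a' a + RInt g b b') by ring.
      revert Ha1 Ha1' Hb1 Hb1' X Y.
      unfold Rabs; repeat destruct Rcase_abs; lra. }
  destruct E as [l Hl]. exists l.
  intros P HP. specialize (Hl P HP). unfold filtermapi. unfold filtermap in Hl.
  assert (Q := prod_pos (fun y => 0 < y) (fun y h => h)).
  generalize (filter_and _ _ Hl Q). apply filter_imp.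
  intros [a b] [HPab Hab]. cbn [fst snd] in *.
  exists (RInt g a b). split; trivial.
  apply (RInt_correct (V := R_CompleteNormedModule)).
  apply continuous_ex_RInt_pos; trivial; apply Hab.
  - split; [apply Rmin_l | apply Rmax_l].
  - split; [apply Rmin_r | apply Rmax_r].
Qed.

(** * Symbols on the positive half-line *)

Lemma Rpower_pos x c : 0 < Rpower x c.
Proof. apply exp_pos. Qed.

Lemma Rpower_le_large y c d : 1 <= y -> c <= d -> Rpower y c <= Rpower y d.
Proof.
  intros Hy H. destruct (Req_dec y 1) as [->|n].
  - unfold Rpower. rewrite ln_1, !Rmult_0_r. lra.
  - apply Rle_Rpower; lra.
Qed.

Lemma Rpower_le_small y c d : 0 < y <= 1 -> c <= d -> Rpower y d <= Rpower y c.
Proof.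
  intros Hy H. unfold Rpower.
  destruct (Req_dec (d * ln y) (c * ln y)) as [->|n]; [lra|].
  apply Rlt_le, exp_increasing.
  assert (ln y <= 0). { rewrite <- ln_1. apply ln_le; lra. }
  nra.
Qed.

Definition power_bound (a : R) (w : R -> R) : Prop :=
  exists C, forall y, 0 < y -> Rabs (w y) <= C * Rpower y a.

Lemma power_bound_nonneg a w :
  power_bound a w -> exists C, 0 <= C /\ forall y, 0 < y -> Rabs (w y) <= C * Rpower y a.
Proof.
  intros [C H]. exists (Rabs C). split; [apply Rabs_pos|]. intros y Hy.
  apply Rle_trans with (1 := H y Hy), Rmult_le_compat_r, Rle_abs.
  apply Rlt_le, Rpower_pos.
Qed.

(** On (0, 1] the larger exponent gives the stronger bound, on [1, oo) the smaller one; together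
    they dominate every power in between. *)
Lemma power_bound_between a b c w :
  a <= c <= b -> power_bound a w -> power_bound b w -> power_bound c w.
Proof.
  intros H Ha Hb.
  destruct (power_bound_nonneg _ _ Ha) as [C [C0 HC]].
  destruct (power_bound_nonneg _ _ Hb) as [D [D0 HD]].
  exists (C + D). intros y Hy.
  assert (P := Rpower_pos y c).
  destruct (Rle_dec y 1) as [h|h].
  - apply Rle_trans with (1 := HD y Hy).
    apply Rle_trans with (D * Rpower y c); [|nra].
    apply Rmult_le_compat_l, Rpower_le_small; lra.
  - apply Rle_trans with (1 := HC y Hy).
    apply Rle_trans with (C * Rpower y c); [|nra].
    apply Rmult_le_compat_l, Rpower_le_large; lra.
Qed.

Lemma power_bound_ext a w v :
  (forall y, 0 < y -> w y = v y) -> power_bound a w -> power_bound a v.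
Proof.
  intros E [C H]. exists C. intros y Hy. rewrite <- E by trivial. now apply H.
Qed.

Lemma power_bound_plus a w v :
  power_bound a w -> power_bound a v -> power_bound a (fun y => w y + v y).
Proof.
  intros [C H] [D K]. exists (C + D). intros y Hy.
  apply Rle_trans with (1 := Rabs_triang _ _).
  specialize (H y Hy). specialize (K y Hy). lra.
Qed.

Lemma power_bound_mult a b w v :
  power_bound a w -> power_bound b v -> power_bound (a + b) (fun y => w y * v y).
Proof.
  intros [C H] [D K]. exists (C * D). intros y Hy.
  rewrite Rabs_mult, Rpower_plus.
  replace (C * D * (Rpower y a * Rpower y b))
    with (C * Rpower y a * (D * Rpower y b)) by ring.
  apply Rmult_le_compat; auto using Rabs_pos.
Qed.

Lemma power_bound_Rpower c : power_bound c (fun y => Rpower y c).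
Proof.
  exists 1. intros y _. rewrite Rabs_pos_eq; [lra|]. apply Rlt_le, Rpower_pos.
Qed.

(** The class |w^(j)| <= C min(y^(a-j), y^(b-j)) for j <= n, as for powers of y: b is the order at
    0, a the order at infinity, and exponents add under products. The derivative is a witness rather
    than [Derive], so that the closure rules are plain inductions. *)
Fixpoint symbol (n : nat) (a b : R) (w : R -> R) : Prop :=
  power_bound a w /\ power_bound b w /\
  match n with
  | O => forall y, 0 < y -> continuous w y
  | S n => exists w', (forall y, 0 < y -> is_derive w y (w' y)) /\ symbol n (a - 1) (b - 1) w'
  end.

Lemma symbol_bounds n a b w : symbol n a b w -> power_bound a w /\ power_bound b w.
Proof. destruct n; cbn; tauto. Qed.

Lemma symbol_continuous n a b w : symbol n a b w -> forall y, 0 < y -> continuous w y.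
Proof.
  destruct n; cbn; [tauto|]. intros (_ & _ & w' & H & _) y Hy.
  apply (ex_derive_continuous (V := R_NormedModule)). eexists. now apply H.
Qed.

Lemma symbol_pred n a b w : symbol (S n) a b w -> symbol n a b w.
Proof.
  revert a b w. induction n as [|n IH]; intros a b w H.
  - cbn. split; [apply H|]. split; [apply H|]. exact (symbol_continuous _ _ _ _ H).
  - destruct H as (Ha & Hb & w' & H & K). split; [|split]; trivial.
    exists w'. split; trivial. now apply IH.
Qed.

Lemma symbol_ext n a b w v :
  (forall y, 0 < y -> w y = v y) -> symbol n a b w -> symbol n a b v.
Proof.
  intros E. destruct n as [|n]; intros (Ha & Hb & H); (split; [|split]).
  1, 2, 4, 5: now apply power_bound_ext with w.
  - intros y Hy. apply continuous_ext_loc with w; [|now apply H].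
    now apply locally_pos.
  - destruct H as (w' & H & K). exists w'. split; trivial. intros y Hy.
    apply is_derive_ext_loc with w; [|now apply H]. now apply locally_pos.
Qed.

Lemma symbol_between n a b a' b' w :
  a <= a' <= b -> a <= b' <= b -> symbol n a b w -> symbol n a' b' w.
Proof.
  revert a b a' b' w. induction n as [|n IH]; intros a b a' b' w h k (Ha & Hb & H);
    (split; [|split]).
  1, 2, 4, 5: apply power_bound_between with a b; trivial.
  - trivial.
  - destruct H as (w' & H & K). exists w'. split; trivial.
    apply IH with (3 := K); lra.
Qed.

Lemma symbol_plus n a b w v :
  symbol n a b w -> symbol n a b v -> symbol n a b (fun y => w y + v y).
Proof.
  revert a b w v. induction n as [|n IH]; intros a b w v (Ha & Hb & H) (Ka & Kb & K);
    (split; [|split]).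
  1, 2, 4, 5: now apply power_bound_plus.
  - intros y Hy. apply (continuous_plus (V := R_NormedModule)); auto.
  - destruct H as (w' & H & H'), K as (v' & K & K').
    exists (fun y => w' y + v' y). split; [|now apply IH].
    intros y Hy. apply (is_derive_plus (V := R_NormedModule)); auto.
Qed.

Lemma symbol_mult n a b a' b' w v :
  symbol n a b w -> symbol n a' b' v -> symbol n (a + a') (b + b') (fun y => w y * v y).
Proof.
  revert a b a' b' w v. induction n as [|n IH]; intros a b a' b' w v W V.
  - destruct W as (Ha & Hb & H), V as (Ka & Kb & K). split; [|split].
    1, 2: now apply power_bound_mult.
    intros y Hy. apply (continuous_mult (K := R_AbsRing)); auto.
  - generalize (symbol_pred _ _ _ _ W) (symbol_pred _ _ _ _ V); intros W1 V1.
    destruct W as (Ha & Hb & w' & H & H'), V as (Ka & Kb & v' & K & K').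
    split; [|split].
    1, 2: now apply power_bound_mult.
    exists (fun y => w' y * v y + w y * v' y). split.
    + intros y Hy. apply (is_derive_mult w v y); auto. intros; apply Rmult_comm.
    + apply symbol_plus.
      * replace (a + a' - 1) with (a - 1 + a') by ring.
        replace (b + b' - 1) with (b - 1 + b') by ring. now apply IH.
      * replace (a + a' - 1) with (a + (a' - 1)) by ring.
        replace (b + b' - 1) with (b + (b' - 1)) by ring. now apply IH.
Qed.

Lemma is_derive_Rpower c y :
  0 < y -> is_derive (fun y => Rpower y c) y (c * Rpower y (c - 1)).
Proof.
  intros Hy. unfold Rpower at 1. auto_derive; trivial.
  fold (Rpower y c). unfold Rminus. rewrite Rpower_plus, Rpower_Ropp, Rpower_1 by trivial.
  field. lra.
Qed.

Lemma symbol_scal n a b c w : symbol n a b w -> symbol n a b (fun y => c * w y).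
Proof.
  assert (Z : forall d, power_bound d w -> power_bound d (fun y => c * w y)).
  { intros d [C H]. exists (Rabs c * C). intros y Hy. rewrite Rabs_mult, Rmult_assoc.
    apply Rmult_le_compat_l; auto using Rabs_pos. }
  revert a b w Z. induction n as [|n IH]; intros a b w Z (Ha & Hb & H); (split; [|split]); auto.
  - intros y Hy. apply (continuous_scal_r (V := R_NormedModule) c w); auto.
  - destruct H as (w' & H & K). exists (fun y => c * w' y). split.
    + intros y Hy. apply is_derive_scal; auto.
    + apply IH; trivial. intros d [C HC]. exists (Rabs c * C). intros y Hy.
      rewrite Rabs_mult, Rmult_assoc. apply Rmult_le_compat_l; auto using Rabs_pos.
Qed.

Lemma symbol_Rpower n c : symbol n c c (fun y => Rpower y c).
Proof.
  revert c. induction n as [|n IH]; intros c; (split; [|split]).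
  1, 2, 4, 5: apply power_bound_Rpower.
  - intros y Hy. apply (ex_derive_continuous (V := R_NormedModule)).
    eexists; now apply is_derive_Rpower.
  - exists (fun y => c * Rpower y (c - 1)). split.
    + intros; now apply is_derive_Rpower.
    + now apply symbol_scal.
Qed.

Lemma symbol_pow n k : symbol n (INR k) (INR k) (fun y => y ^ k).
Proof.
  apply symbol_ext with (2 := symbol_Rpower n (INR k)).
  intros y Hy. now apply Rpower_pow.
Qed.

(** The tangent to [ln] at c + 1 bounds c ln t by c ln (c + 1) + c t / (c + 1) - c. Taking c + 1
    instead of the optimal c includes the case c = 0. *)
Lemma exp_neg_le_Rpower c :
  0 <= c -> exists C, 0 < C /\ forall t, 0 < t -> exp (- t) <= C * Rpower t (- c).
Proof.
  intros Hc. exists (exp ((c + 1) * ln (c + 1))). split; [apply exp_pos|].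
  intros t Ht. unfold Rpower. rewrite <- exp_plus.
  assert (ln t <= ln (c + 1) + (t / (c + 1) - 1)).
  { replace t with ((c + 1) * (t / (c + 1))) at 1 by (field; lra).
    assert (0 < t / (c + 1)) by (apply Rdiv_lt_0_compat; lra).
    rewrite ln_mult by lra.
    generalize (exp_ineq1_le (ln (t / (c + 1)))). rewrite exp_ln by trivial. lra. }
  assert (Hl : 0 <= ln (c + 1)).
  { rewrite <- ln_1. apply ln_le; lra. }
  assert (- t <= (c + 1) * ln (c + 1) + - c * ln t).
  { assert (c * ln t <= c * ln (c + 1) + c * (t / (c + 1)) - c) by nra.
    assert (c * (t / (c + 1)) <= t).
    { replace (c * (t / (c + 1))) with (t * (c / (c + 1))) by (field; lra).
      assert (c / (c + 1) <= 1).
      { apply Rmult_le_reg_r with (c + 1); [lra|]. field_simplify; lra. }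
      nra. }
    nra. }
  destruct (Req_dec (- t) ((c + 1) * ln (c + 1) + - c * ln t)) as [<-|n]; [lra|].
  apply Rlt_le, exp_increasing. lra.
Qed.

(** * Flat functions and the cut-off *)

Definition flat_exp (y : R) : R := exp (- / y).

Lemma flat_exp_bounds b : 0 <= b -> power_bound 0 flat_exp /\ power_bound b flat_exp.
Proof.
  assert (W : forall b, 0 <= b -> power_bound b flat_exp).
  { clear. intros b Hb. destruct (exp_neg_le_Rpower b Hb) as (C & _ & H).
    exists C. intros y Hy. unfold flat_exp. rewrite Rabs_pos_eq by apply Rlt_le, exp_pos.
    apply Rle_trans with (1 := H _ (Rinv_0_lt_compat _ Hy)). apply Req_le. f_equal.
    unfold Rpower. rewrite ln_Rinv by trivial. f_equal. ring. }
  intros Hb; split; apply W; lra.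
Qed.

Lemma is_derive_flat_exp y :
  0 < y -> is_derive flat_exp y (Rpower y (- 2) * flat_exp y).
Proof.
  intros Hy. unfold flat_exp. auto_derive; [lra|].
  replace (- 2) with (- INR 2) by (simpl; ring).
  rewrite Rpower_Ropp, Rpower_pow by trivial. field. lra.
Qed.

Lemma symbol_flat_exp n b : 0 <= b -> symbol n 0 b flat_exp.
Proof.
  revert b. induction n as [|n IH]; intros b Hb; (split; [|split]);
    try now apply (flat_exp_bounds b).
  - intros y Hy. apply (ex_derive_continuous (V := R_NormedModule)).
    eexists; now apply is_derive_flat_exp.
  - exists (fun y => Rpower y (- 2) * flat_exp y).
    split; [intros; now apply is_derive_flat_exp|].
    (* The factor y^(-2) is absorbed by using flatness of order b + 1 in place of b. *)
    apply symbol_between with (- 2 + 0) (- 2 + (b + 1)); [lra| lra|].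
    apply symbol_mult; [apply symbol_Rpower | apply IH; lra].
Qed.

(** Flat at 0 and asymptotic to y - 1 at infinity. The first factor is written [Rpower y 1] so that
    the symbol rules for powers apply. *)
Definition cutoff_phase (y : R) : R := Rpower y 1 * flat_exp y.

Lemma symbol_cutoff_phase n b : 1 <= b -> symbol n 1 b cutoff_phase.
Proof.
  intros Hb. apply symbol_between with (1 + 0) (1 + (b - 1)); [lra|lra|].
  apply symbol_mult; [apply symbol_Rpower | apply symbol_flat_exp; lra].
Qed.

(* On (0, oo) this equals 1 to infinite order at 0 and decays rapidly at
   infinity, which is all that is needed of a cut-off function. *)
Definition cutoff (y : R) : R := exp (- cutoff_phase y).

Lemma cutoff_phase_pos y : 0 < cutoff_phase y.
Proof. apply Rmult_lt_0_compat; apply exp_pos. Qed.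

Lemma cutoff_le_1 y : 0 < cutoff y <= 1.
Proof.
  split; [apply exp_pos|]. unfold cutoff. rewrite <- exp_0.
  apply Rlt_le, exp_increasing. generalize (cutoff_phase_pos y). lra.
Qed.

Lemma power_bound_cutoff a : a <= 0 -> power_bound a cutoff.
Proof.
  intros Ha. destruct (exp_neg_le_Rpower (- a)) as (C & C0 & HC); [lra|].
  exists (1 + C * Rpower (exp (- 1)) a). intros y Hy.
  rewrite Rabs_pos_eq by apply Rlt_le, cutoff_le_1.
  assert (P := Rpower_pos y a). assert (Q := Rpower_pos (exp (-1)) a).
  destruct (Rle_dec y 1) as [h|h].
  - apply Rle_trans with (1 := proj2 (cutoff_le_1 y)).
    assert (1 <= Rpower y a). { rewrite <- (Rpower_O y) by trivial. apply Rpower_le_small; lra. }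
    assert (0 <= C * Rpower (exp (-1)) a) by nra. nra.
  (* For y > 1, exp(-1/y) >= exp(-1), so [cutoff y] lies below exp(-y/e), which beats every negative
     power of y. *)
  - assert (K : cutoff y <= C * Rpower (y * exp (- 1)) a).
    { assert (T : 0 < y * exp (- 1)) by (apply Rmult_lt_0_compat; [lra|apply exp_pos]).
      generalize (HC _ T). rewrite Ropp_involutive. apply Rle_trans.
      unfold cutoff, cutoff_phase, flat_exp. rewrite Rpower_1 by trivial.
      assert (exp (- 1) <= exp (- / y)).
      { destruct (Req_dec (- 1) (- / y)) as [<-|n]; [lra|]. apply Rlt_le, exp_increasing.
        assert (/ y < 1) by (rewrite <- Rinv_1; apply Rinv_lt_contravar; lra). lra. }
      destruct (Req_dec (- (y * exp (- / y))) (- (y * exp (-1)))) as [<-|n]; [lra|].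
      apply Rlt_le, exp_increasing. nra. }
    apply Rle_trans with (1 := K).
    rewrite <- Rpower_mult_distr by (trivial; apply exp_pos). nra.
Qed.

Lemma symbol_cutoff_derive n b : 1 <= b ->
  exists phase', (forall y, 0 < y -> is_derive cutoff_phase y (phase' y)) /\
    symbol n 0 (b - 1) phase'.
Proof.
  intros Hb. destruct (symbol_cutoff_phase (S n) b Hb) as (_ & _ & w' & H & K).
  exists w'. split; trivial. now replace 0 with (1 - 1) by ring.
Qed.

Lemma is_derive_cutoff y d :
  is_derive cutoff_phase y d -> is_derive cutoff y (- 1 * d * cutoff y).
Proof.
  intros H. unfold cutoff. auto_derive; [now exists d|].
  replace (Derive (fun x => cutoff_phase x) y) with d.
  - ring.
  - symmetry. now apply is_derive_unique.
Qed.

Lemma symbol_cutoff n a : a <= 0 -> symbol n a 0 cutoff.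
Proof.
  revert a. induction n as [|n IH]; intros a Ha; (split; [|split]);
    try (apply power_bound_cutoff; lra).
  - intros y Hy. apply (ex_derive_continuous (V := R_NormedModule)).
    destruct (symbol_cutoff_derive O 1) as (d & H & _); [lra|].
    eexists; now apply is_derive_cutoff, H.
  - destruct (symbol_cutoff_derive n 1) as (d & H & K); [lra|].
    exists (fun y => - 1 * d y * cutoff y). split; [intros; now apply is_derive_cutoff, H|].
    apply symbol_between with (0 + (a - 1)) (1 - 1 + 0); [lra|lra|].
    apply symbol_mult; [now apply symbol_scal | apply IH; lra].
Qed.

(** The inequality 1 - exp(-t) <= t passes on the flatness of [cutoff_phase], and the derivative is
    the product of the derivative of [cutoff_phase] with [cutoff]. Orders b >= 1 come first because
    [cutoff_phase] grows like y; interpolation reaches the others. *)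
Lemma symbol_one_minus_cutoff n b : 0 <= b -> symbol n 0 b (fun y => 1 - cutoff y).
Proof.
  assert (W : forall n b, 1 <= b -> symbol n 0 b (fun y => 1 - cutoff y)).
  { clear n b. intros n b Hb.
    assert (P0 : power_bound 0 (fun y => 1 - cutoff y)).
    { exists 1. intros y Hy. rewrite Rpower_O by trivial. generalize (cutoff_le_1 y).
      intros; rewrite Rabs_pos_eq; lra. }
    assert (Pb : power_bound b (fun y => 1 - cutoff y)).
    { destruct (symbol_bounds _ _ _ _ (symbol_cutoff_phase n b Hb)) as [_ [C H]].
      exists C. intros y Hy. apply Rle_trans with (2 := H y Hy).
      rewrite (Rabs_pos_eq (cutoff_phase y)) by apply Rlt_le, cutoff_phase_pos.
      generalize (cutoff_le_1 y) (exp_ineq1_le (- cutoff_phase y)). fold (cutoff y).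
      intros; rewrite Rabs_pos_eq; lra. }
    assert (D : forall n, exists v,
      (forall y, 0 < y -> is_derive (fun y => 1 - cutoff y) y (v y)) /\
      symbol n (0 - 1) (b - 1) v).
    { clear n. intros n. destruct (symbol_cutoff_derive n b) as (d & H & K); [lra|].
      exists (fun y => d y * cutoff y). split.
      - intros y Hy. replace (d y * cutoff y) with (0 - (- 1 * d y * cutoff y)) by ring.
        apply (is_derive_minus (V := R_NormedModule)).
        + apply (is_derive_const (V := R_NormedModule)).
        + now apply is_derive_cutoff, H.
      - replace (0 - 1) with (0 + - 1) by ring. replace (b - 1) with (b - 1 + 0) by ring.
        apply symbol_mult; trivial. apply symbol_cutoff. lra. }
    destruct n as [|n]; (split; [|split]); trivial.
    intros y Hy. apply (ex_derive_continuous (V := R_NormedModule)).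
    destruct (D O) as (v & H & _). eexists; now apply H. }
  intros Hb. apply symbol_between with 0 (b + 1); [lra|lra|]. apply W; lra.
Qed.

(** * Integration by parts against an oscillating factor *)

(** The shift [phi] closes the family under the two operations used: integration by parts and
    differentiation in [lam] both turn cosine into sine, that is [phi] into [phi - PI / 2]. *)
Definition osc (p phi lam : R) (w : R -> R) (y : R) : R :=
  cos (lam * Rpower y p + phi) * w y.

Lemma osc_bound p phi lam w y : Rabs (osc p phi lam w y) <= Rabs (w y).
Proof.
  unfold osc. rewrite Rabs_mult.
  assert (Rabs (cos (lam * Rpower y p + phi)) <= 1) by (apply Rabs_le, COS_bound).
  generalize (Rabs_pos (w y)). nra.
Qed.

Lemma is_derive_osc_phase p lam phi y : 0 < y ->
  is_derive (fun y => lam * Rpower y p + phi) y (lam * p * Rpower y (p - 1)).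
Proof.
  intros Hy. replace (lam * p * Rpower y (p - 1)) with (lam * (p * Rpower y (p - 1)) + 0) by ring.
  apply (is_derive_plus (V := R_NormedModule)).
  - apply is_derive_scal. now apply is_derive_Rpower.
  - apply (is_derive_const (V := R_NormedModule)).
Qed.

Lemma osc_continuous p phi lam w y : 0 < y ->
  continuous w y -> continuous (osc p phi lam w) y.
Proof.
  intros Hy H. apply (continuous_mult (K := R_AbsRing)); trivial.
  apply continuous_cos_comp.
  apply (ex_derive_continuous (V := R_NormedModule)).
  eexists; now apply is_derive_osc_phase.
Qed.

Lemma integrable_bound w :
  power_bound (- 2) w -> power_bound 0 w ->
  exists D, forall y, 0 < y -> Rabs (w y) <= D / (1 + y ^ 2).
Proof.
  intros [C H] [D K]. exists (C + D). intros y Hy.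
  specialize (H y Hy). specialize (K y Hy).
  rewrite Rpower_O in K by trivial.
  replace (- 2) with (- INR 2) in H by (simpl; ring).
  rewrite Rpower_Ropp, Rpower_pow in H by trivial.
  assert (0 < y ^ 2) by (apply pow_lt; trivial).
  apply Rmult_le_reg_r with (1 + y ^ 2); [lra|].
  replace ((C + D) / (1 + y ^ 2) * (1 + y ^ 2)) with (C + D) by (field; lra).
  assert (Rabs (w y) * y ^ 2 <= C).
  { replace C with (C * / y ^ 2 * y ^ 2) by (field; lra).
    apply Rmult_le_compat_r; lra. }
  lra.
Qed.

Lemma ex_osc_int p phi lam w n a b :
  symbol n a b w -> a <= - 2 -> 0 <= b -> exists l, is_int_pos (osc p phi lam w) l.
Proof.
  intros H Ha Hb.
  destruct (integrable_bound w) as [D HD].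
  1, 2: destruct (symbol_bounds _ _ _ _ H); apply power_bound_between with a b; trivial; lra.
  apply ex_int_pos_dominated with D.
  - intros y Hy. apply osc_continuous; trivial. now apply (symbol_continuous _ _ _ _ H).
  - intros y Hy. apply Rle_trans with (1 := osc_bound _ _ _ _ _), HD, Hy.
Qed.

Lemma filterlim_Rpower_0 c : 0 < c -> filterlim (fun y => Rpower y c) (at_right 0) (locally 0).
Proof.
  intros Hc. apply filterlim_locally. intros eps.
  exists (mkposreal _ (Rpower_pos eps (/ c))). intros y Hy Hy0.
  change (Rabs (y - 0) < Rpower eps (/ c)) in Hy.
  rewrite Rminus_0_r, Rabs_pos_eq in Hy by lra.
  change (Rabs (Rpower y c - 0) < eps).
  rewrite Rminus_0_r, Rabs_pos_eq by apply Rlt_le, Rpower_pos.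
  replace (pos eps) with (Rpower (Rpower eps (/ c)) c).
  - apply Rlt_Rpower_l; lra.
  - rewrite Rpower_mult, Rinv_l, Rpower_1; [trivial|apply cond_pos|lra].
Qed.

Lemma is_lim_Rpower_infty c : c < 0 -> is_lim (fun y => Rpower y c) p_infty 0.
Proof.
  intros Hc. apply is_lim_spec. intros eps.
  exists (Rpower eps (/ c)). intros y Hy.
  assert (P := Rpower_pos eps (/ c)).
  rewrite Rminus_0_r, Rabs_pos_eq by apply Rlt_le, Rpower_pos.
  replace (pos eps) with (Rpower (Rpower eps (/ c)) c).
  - replace c with (- - c) by ring.
    rewrite (Rpower_Ropp y), (Rpower_Ropp (Rpower eps (/ - - c))).
    rewrite Ropp_involutive.
    apply Rinv_lt_contravar.
    + apply Rmult_lt_0_compat; apply Rpower_pos.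
    + apply Rlt_Rpower_l; lra.
  - rewrite Rpower_mult, Rinv_l, Rpower_1; [trivial|apply cond_pos|lra].
Qed.

Lemma filterlim_dominated_0 (F : (R -> Prop) -> Prop) {FF : Filter F} (f g : R -> R) :
  F (fun y => Rabs (f y) <= g y) -> filterlim g F (locally 0) -> filterlim f F (locally 0).
Proof.
  intros H Hg. apply filterlim_locally. intros eps.
  apply filterlim_locally with (eps := eps) in Hg.
  generalize (filter_and _ _ H Hg). apply filter_imp. intros y [K1 K2].
  change (Rabs (g y - 0) < eps) in K2. change (Rabs (f y - 0) < eps).
  rewrite Rminus_0_r in *. apply Rle_lt_trans with (1 := K1).
  apply Rle_lt_trans with (2 := K2), Rle_abs.
Qed.

Lemma scal_lim_0 (F : (R -> Prop) -> Prop) {FF : Filter F} (g : R -> R) c :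
  filterlim g F (locally 0) -> filterlim (fun y => c * g y) F (locally 0).
Proof.
  intros H. replace (locally 0) with (locally (c * 0)) by now rewrite Rmult_0_r.
  apply filterlim_comp with (1 := H).
  apply (filterlim_scal_r (V := R_NormedModule) c 0).
Qed.

Lemma power_bound_lim_0 c w : 0 < c -> power_bound c w -> filterlim w (at_right 0) (locally 0).
Proof.
  intros Hc [C H]. apply filterlim_dominated_0 with (fun y => C * Rpower y c).
  - apply _.
  - exists (mkposreal 1 Rlt_0_1). intros y _ Hy. now apply H.
  - apply scal_lim_0; [apply _|]. now apply filterlim_Rpower_0.
Qed.

Lemma power_bound_lim_infty c w : c < 0 -> power_bound c w -> is_lim w p_infty 0.
Proof.
  intros Hc [C H]. 
  apply (filterlim_dominated_0 (Rbar_locally p_infty)) with (fun y => C * Rpower y c).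
  - exists 0. intros y Hy. now apply H.
  - apply scal_lim_0; [apply _|]. now apply is_lim_Rpower_infty.
Qed.

Lemma cos_minus_half_pi x : cos (x - PI / 2) = sin x.
Proof. rewrite cos_minus, cos_PI2, sin_PI2. ring. Qed.

Lemma osc_sin p phi lam w y :
  osc p (phi - PI / 2) lam w y = sin (lam * Rpower y p + phi) * w y.
Proof.
  unfold osc. f_equal. rewrite <- cos_minus_half_pi. f_equal. ring.
Qed.

(* One integration by parts against
   [cos (lam y^p + phi) = d/dy (sin (lam y^p + phi)) * y^(1-p) / (lam p)]. *)
Lemma osc_by_parts p n a b w : 0 < p -> symbol (S n) a b w -> a <= - 2 -> p <= b ->
  exists v, symbol n (a - p) (b - p) v /\
    (forall y, 0 < y -> is_derive (fun y => Rpower y (1 - p) * w y) y (v y)) /\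
    forall phi lam l, 0 < lam -> is_int_pos (osc p phi lam w) l ->
    exists l', is_int_pos (osc p (phi - PI / 2) lam v) l' /\ l = - / (lam * p) * l'.
Proof.
  intros Hp W Ha Hb.
  assert (X := symbol_mult _ _ _ _ _ _ _ (symbol_Rpower (S n) (1 - p)) W).
  destruct X as (Xa & Xb & v & Hv & V).
  replace (1 - p + a - 1) with (a - p) in V by ring.
  replace (1 - p + b - 1) with (b - p) in V by ring.
  exists v. split; [|split]; trivial. intros phi lam l Hlam Hl.
  destruct (ex_osc_int p (phi - PI / 2) lam v n _ _ V) as [l' Hl']; [lra|lra|].
  exists l'. split; trivial.
  assert (Q : lam * p <> 0) by nra.
  set (u := fun y => Rpower y (1 - p) * w y) in *.
  set (c := / (lam * p)).
  (* The boundary terms vanish: u = y^(1-p) w has order 1 - p + b >= 1 at 0 and 1 - p + a < 0 at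
     infinity. *)
  assert (K : is_int_pos (fun y => osc p phi lam w y + c * osc p (phi - PI / 2) lam v y) (0 - 0)).
  { apply is_int_pos_derive with (fun y => c * (sin (lam * Rpower y p + phi) * u y)).
    - intros y Hy.
      evar_last.
      + apply is_derive_scal, (is_derive_mult (fun y => sin (lam * Rpower y p + phi)) u).
        * apply (is_derive_comp sin); [apply is_derive_sin | now apply is_derive_osc_phase].
        * now apply Hv.
        * intros; apply Rmult_comm.
      + change (c * (lam * p * Rpower y (p - 1) * cos (lam * Rpower y p + phi) * u y
          + sin (lam * Rpower y p + phi) * v y)
          = osc p phi lam w y + c * osc p (phi - PI / 2) lam v y).
        rewrite osc_sin. unfold osc, u.
        replace (c * (lam * p * Rpower y (p - 1) * cos (lam * Rpower y p + phi) *
            (Rpower y (1 - p) * w y) + sin (lam * Rpower y p + phi) * v y))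
          with (c * (lam * p) * (Rpower y (p - 1) * Rpower y (1 - p)) *
            (cos (lam * Rpower y p + phi) * w y)
            + c * (sin (lam * Rpower y p + phi) * v y)) by ring.
        rewrite <- Rpower_plus. replace (p - 1 + (1 - p)) with 0 by ring.
        rewrite Rpower_O by trivial. unfold c. rewrite Rinv_l by trivial. ring.
    - intros y Hy. apply (continuous_plus (V := R_NormedModule)).
      + apply osc_continuous; trivial. now apply (symbol_continuous _ _ _ _ W).
      + apply (continuous_scal_r (V := R_NormedModule)).
        apply osc_continuous; trivial. now apply (symbol_continuous _ _ _ _ V).
    - apply scal_lim_0; [apply _|].
      apply power_bound_lim_0 with (1 - p + b); [lra|].
      destruct Xb as [C HC]. exists C. intros y Hy. rewrite <- osc_sin.
      apply Rle_trans with (1 := osc_bound _ _ _ _ _). now apply HC.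
    - apply (scal_lim_0 (Rbar_locally p_infty)).
      apply power_bound_lim_infty with (1 - p + a); [lra|].
      destruct Xa as [C HC]. exists C. intros y Hy. rewrite <- osc_sin.
      apply Rle_trans with (1 := osc_bound _ _ _ _ _). now apply HC. }
  assert (E := is_int_pos_unique _ _ _ K
    (is_int_pos_plus _ _ _ _ Hl (is_int_pos_scal _ c _ Hl'))).
  fold c. clearbody c. nra.
Qed.

(** Each integration by parts costs p in the order at 0 and gains a factor 1 / lam. The constant is
    uniform in [phi], as the induction requires, since every step shifts the phase. *)
Lemma osc_flat p J a b w : 0 < p -> symbol J a b w -> a <= - 2 -> INR J * p <= b ->
  exists M, forall phi lam l, 0 < lam -> is_int_pos (osc p phi lam w) l ->
    Rabs l <= M * Rpower lam (- INR J).
Proof.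
  intros Hp. revert a b w. induction J as [|J IH]; intros a b w W Ha Hb.
  - destruct (integrable_bound w) as [D HD].
    1, 2: destruct (symbol_bounds _ _ _ _ W); apply power_bound_between with a b; trivial;
      simpl in Hb; lra.
    exists (2 * Rabs D). intros phi lam l Hlam Hl.
    simpl INR. rewrite Ropp_0, Rpower_O, Rmult_1_r by trivial.
    apply is_int_pos_bound with (2 := Hl).
    intros y Hy. apply Rle_trans with (1 := osc_bound _ _ _ _ _), HD, Hy.
  - rewrite S_INR in Hb. assert (0 <= INR J * p) by (generalize (pos_INR J); nra).
    destruct (osc_by_parts p J a b w Hp W Ha) as (v & V & _ & HV); [lra|].
    destruct (IH _ _ _ V) as [M HM]; [lra|lra|].
    exists (/ p * M). intros phi lam l Hlam Hl.
    destruct (HV phi lam l Hlam Hl) as (l' & Hl' & ->).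
    specialize (HM _ _ _ Hlam Hl').
    rewrite S_INR, Ropp_plus_distr, Rpower_plus, (Rpower_Ropp lam 1), Rpower_1 by trivial.
    rewrite Rabs_mult, Rabs_Ropp, Rabs_pos_eq by (apply Rlt_le, Rinv_0_lt_compat; nra).
    replace (/ p * M * (Rpower lam (- INR J) * / lam))
      with (/ (lam * p) * (M * Rpower lam (- INR J))) by (field; lra).
    apply Rmult_le_compat_l; trivial. apply Rlt_le, Rinv_0_lt_compat; nra.
Qed.

(** * The model integrals and their constants *)

Lemma sin_lipschitz x y : Rabs (sin y - sin x) <= Rabs (y - x).
Proof.
  destruct (MVT_gen sin x y cos) as (c & _ & ->).
  - intros; apply is_derive_sin.
  - intros; apply continuity_sin.
  - rewrite Rabs_mult.
    assert (Rabs (cos c) <= 1) by (apply Rabs_le, COS_bound).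
    generalize (Rabs_pos (y - x)). nra.
Qed.

Lemma cos_taylor_1 x s : Rabs (cos (x + s) - cos x + s * sin x) <= s ^ 2.
Proof.
  destruct (MVT_gen (fun s => cos (x + s) + s * sin x) 0 s (fun s => - sin (x + s) + sin x))
    as (c & Hc & E).
  - intros z _. auto_derive; trivial. ring.
  - intros z _. apply continuity_pt_filterlim.
    apply (ex_derive_continuous (K := R_AbsRing) (V := R_NormedModule)
      (fun s => cos (x + s) + s * sin x)). auto_derive. trivial.
  - rewrite Rplus_0_r in E.
    replace (cos (x + s) - cos x + s * sin x)
      with ((- sin (x + c) + sin x) * (s - 0)) by lra.
    rewrite Rabs_mult, Rminus_0_r.
    assert (K := sin_lipschitz (x + c) x).
    replace (- sin (x + c) + sin x) with (sin x - sin (x + c)) by ring.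
    replace (x - (x + c)) with (- c) in K by ring. rewrite Rabs_Ropp in K.
    assert (Rabs c <= Rabs s).
    { revert Hc. unfold Rmin, Rmax, Rabs. destruct Rle_dec; repeat destruct Rcase_abs; lra. }
    rewrite <- (pow2_abs s). generalize (Rabs_pos s) (Rabs_pos c). nra.
Qed.

Lemma is_derive_of_quadratic (E : R -> R) x l C :
  (forall h, Rabs (E (x + h) - E x - h * l) <= C * h ^ 2) -> is_derive E x l.
Proof.
  intros H. apply is_derive_Reals. intros eps Heps.
  assert (P : 0 < eps / (Rabs C + 1)).
  { apply Rdiv_lt_0_compat; trivial. generalize (Rabs_pos C). lra. }
  exists (mkposreal _ P). intros h Hh Hd. cbn in Hd.
  replace ((E (x + h) - E x) / h - l) with ((E (x + h) - E x - h * l) * / h) by (field; trivial).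
  rewrite Rabs_mult, Rabs_inv.
  assert (0 < Rabs h) by now apply Rabs_pos_lt.
  apply Rle_lt_trans with (C * h ^ 2 * / Rabs h).
  - apply Rmult_le_compat_r; [|apply H]. now apply Rlt_le, Rinv_0_lt_compat.
  - rewrite <- pow2_abs. replace (C * Rabs h ^ 2 * / Rabs h) with (C * Rabs h) by (field; lra).
    generalize (Rabs_pos C) (Rle_abs C); intros.
    apply Rle_lt_trans with ((Rabs C + 1) * Rabs h); [nra|].
    replace eps with ((Rabs C + 1) * (eps / (Rabs C + 1))) by (field; lra).
    apply Rmult_lt_compat_l; lra.
Qed.

(** Differentiation under the integral sign with an explicit remainder: the first-order Taylor error
    of the cosine is at most (h y^p)^2, and a + 2 p <= -2 makes y^(2p) w integrable, so the
    increment is linear in h up to O(h^2). *)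
Lemma is_derive_osc_int p phi lam n a b w (E : R -> R) l : 0 < p ->
  symbol n a b w -> a + 2 * p <= - 2 -> 0 <= b ->
  (forall lam, is_int_pos (osc p phi lam w) (E lam)) ->
  is_int_pos (osc p (phi - PI / 2) lam (fun y => Rpower y p * w y)) l ->
  is_derive E lam (- l).
Proof.
  intros Hp W Ha Hb HE Hl.
  destruct (integrable_bound (fun y => Rpower y (2 * p) * w y)) as [D HD].
  1, 2: destruct (symbol_bounds _ _ _ _ W) as [Wa Wb].
  1, 2: apply power_bound_between with (2 * p + a) (2 * p + b); [lra| |];
      apply power_bound_mult; trivial; apply power_bound_Rpower.
  apply is_derive_of_quadratic with (2 * Rabs D). intros h.
  assert (K := is_int_pos_plus _ _ _ _ (HE (lam + h))
    (is_int_pos_plus _ _ _ _ (is_int_pos_scal _ (- 1) _ (HE lam)) (is_int_pos_scal _ h _ Hl))).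
  replace (E (lam + h) - E lam - h * - l) with (E (lam + h) + (- 1 * E lam + h * l)) by ring.
  assert (0 <= D).
  { generalize (HD 1 Rlt_0_1) (Rabs_pos (Rpower 1 (2 * p) * w 1)). lra. }
  apply Rle_trans with (2 * Rabs (D * h ^ 2)).
  2: { rewrite Rabs_mult, (Rabs_pos_eq (h ^ 2)) by apply pow2_ge_0. lra. }
  apply is_int_pos_bound with (2 := K). intros y Hy.
  rewrite osc_sin. unfold osc.
  replace (_ + _) with
    ((cos (lam * Rpower y p + phi + h * Rpower y p) - cos (lam * Rpower y p + phi)
     + h * Rpower y p * sin (lam * Rpower y p + phi)) * w y).
  2: { replace ((lam + h) * Rpower y p + phi)
        with (lam * Rpower y p + phi + h * Rpower y p) by ring. ring. }
  rewrite Rabs_mult.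
  apply Rle_trans with ((h * Rpower y p) ^ 2 * Rabs (w y)).
  { apply Rmult_le_compat_r; [apply Rabs_pos|apply cos_taylor_1]. }
  specialize (HD y Hy). rewrite Rabs_mult, Rabs_pos_eq in HD by apply Rlt_le, Rpower_pos.
  replace (2 * p) with (p + p) in HD by ring. rewrite Rpower_plus in HD.
  replace (D * h ^ 2 / (1 + y ^ 2)) with (h ^ 2 * (D / (1 + y ^ 2))) by (field; nra).
  replace ((h * Rpower y p) ^ 2 * Rabs (w y))
    with (h ^ 2 * (Rpower y p * Rpower y p * Rabs (w y))) by ring.
  apply Rmult_le_compat_l; [apply pow2_ge_0|trivial].
Qed.

Lemma decay_increment (H h : R -> R) C d lam mu : 0 < d ->
  (forall x, 0 < x -> is_derive H x (h x)) ->
  (forall x, 0 < x -> Rabs (h x) <= C * Rpower x (- d - 1)) ->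
  0 < lam -> lam <= mu -> Rabs (H mu - H lam) <= C / d * Rpower lam (- d).
Proof.
  intros Hd HH Hh Hl Hm.
  assert (HC : 0 <= C).
  { specialize (Hh 1 Rlt_0_1). generalize (Rabs_pos (h 1)) (Rpower_pos 1 (- d - 1)). nra. }
  assert (B0 : 0 <= C / d) by (apply Rle_mult_inv_pos; trivial).
  (* For both signs s, the function s H + (C / d) x^(-d) is nonincreasing: its derivative s h - C
     x^(-d-1) is at most 0. The two signs together bound the absolute value. *)
  assert (W : forall s, s = 1 \/ s = - 1 ->
    s * H mu + C / d * Rpower mu (- d) <= s * H lam + C / d * Rpower lam (- d)).
  { intros s Hs.
    assert (HD : forall x, 0 < x -> is_derive (fun x => s * H x + C / d * Rpower x (- d)) x
      (s * h x + C / d * (- d * Rpower x (- d - 1)))).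
    { intros x Hx. apply (is_derive_plus (V := R_NormedModule));
        apply is_derive_scal; [apply HH | apply is_derive_Rpower]; lra. }
    destruct (MVT_gen _ lam mu _ (fun x Hx => HD x ltac:(rewrite Rmin_left in Hx; lra)))
      as (c & Hc & E).
    - intros x Hx. rewrite Rmin_left in Hx by lra.
      apply continuity_pt_filterlim.
      apply (ex_derive_continuous (K := R_AbsRing) (V := R_NormedModule)
        (fun x => s * H x + C / d * Rpower x (- d))).
      eexists. apply HD. lra.
    - rewrite Rmin_left, Rmax_right in Hc by lra.
      assert (0 < c) by lra. specialize (Hh c H0).
      replace (C / d * (- d * Rpower c (- d - 1))) with (- (C * Rpower c (- d - 1))) in E
        by (field; lra).
      assert (s * h c <= C * Rpower c (- d - 1)).
      { revert Hh. unfold Rabs. destruct Rcase_abs; destruct Hs; subst; lra. }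
      nra. }
  assert (P : 0 <= C / d * Rpower mu (- d)).
  { apply Rmult_le_pos; trivial. apply Rlt_le, Rpower_pos. }
  assert (W1 := W 1 (or_introl eq_refl)). assert (W2 := W (- 1) (or_intror eq_refl)).
  apply Rabs_le. lra.
Qed.

(** [decay_increment] makes H Cauchy at infinity; letting its larger argument tend to infinity then
    gives the rate of convergence. *)
Lemma decay_limit (H h : R -> R) C d : 0 < d ->
  (forall x, 0 < x -> is_derive H x (h x)) ->
  (forall x, 0 < x -> Rabs (h x) <= C * Rpower x (- d - 1)) ->
  exists L : R, is_lim H p_infty L /\
    forall lam, 0 < lam -> Rabs (H lam - L) <= C / d * Rpower lam (- d).
Proof.
  intros Hd HH Hh.
  assert (Lim0 := scal_lim_0 (Rbar_locally p_infty) _ (C / d)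
    (is_lim_Rpower_infty (- d) ltac:(lra))).
  assert (E : exists L, filterlim H (Rbar_locally p_infty) (locally L)).
  { apply (filterlim_locally_cauchy (U := R_CompleteSpace)). intros eps.
    assert (K := proj1 (filterlim_locally _ _) Lim0 (pos_div_2 eps)).
    destruct K as [X HX].
    set (x := Rmax (X + 1) 1).
    assert (Hx : 0 < x /\ X < x).
    { unfold x. generalize (Rmax_l (X + 1) 1) (Rmax_r (X + 1) 1). lra. }
    specialize (HX x (proj2 Hx)).
    change (Rabs (C / d * Rpower x (- d) - 0) < eps / 2) in HX.
    rewrite Rminus_0_r in HX.
    exists (fun u => x < u). split; [now exists x|].
    intros u v Hu Hv.
    change (Rabs (H v - H u) < eps).
    assert (Ku := decay_increment H h C d x u Hd HH Hh (proj1 Hx) (Rlt_le _ _ Hu)).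
    assert (Kv := decay_increment H h C d x v Hd HH Hh (proj1 Hx) (Rlt_le _ _ Hv)).
    assert (Z := Rle_abs (C / d * Rpower x (- d))).
    revert Ku Kv. generalize (H u) (H v) (H x). intros.
    apply Rabs_def1; apply Rabs_le_between in Ku; apply Rabs_le_between in Kv; lra. }
  destruct E as [L HL]. exists L. split; trivial.
  intros lam Hlam. apply le_epsilon. intros eps Heps.
  assert (K := proj1 (filterlim_locally _ _) HL (mkposreal eps Heps)).
  destruct K as [X HX].
  set (x := Rmax (X + 1) lam).
  assert (Hx : lam <= x /\ X < x).
  { unfold x. generalize (Rmax_l (X + 1) lam) (Rmax_r (X + 1) lam). lra. }
  specialize (HX x (proj2 Hx)). change (Rabs (H x - L) < eps) in HX.
  assert (Ku := decay_increment H h C d lam x Hd HH Hh Hlam (proj1 Hx)).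
  replace (H lam - L) with ((H x - L) - (H x - H lam)) by ring.
  apply Rle_trans with (1 := Rabs_triang _ _). rewrite Rabs_Ropp. lra.
Qed.

Definition int_pos (g : R -> R) : R := RInt_gen g (at_right 0) (Rbar_locally p_infty).

Lemma is_int_pos_int_pos g l : is_int_pos g l -> is_int_pos g (int_pos g).
Proof.
  intros H. unfold int_pos.
  now rewrite (is_RInt_gen_unique (V := R_CompleteNormedModule) g l H).
Qed.

Definition model (k : nat) (y : R) : R := Rpower y (INR k) * cutoff y.

Lemma symbol_model n k a : a <= INR k -> symbol n a (INR k) (model k).
Proof.
  intros Ha. apply symbol_between with (INR k + (a - INR k)) (INR k + 0); [lra|lra|].
  apply symbol_mult; [apply symbol_Rpower | apply symbol_cutoff; lra].
Qed.

Definition model_int (p phi : R) (k : nat) (lam : R) : R := int_pos (osc p phi lam (model k)).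

Lemma is_int_pos_model p phi k lam :
  is_int_pos (osc p phi lam (model k)) (model_int p phi k lam).
Proof.
  destruct (ex_osc_int p phi lam (model k) 0 (- 2) (INR k)) as [l Hl].
  - apply symbol_model. generalize (pos_INR k). lra.
  - lra.
  - apply pos_INR.
  - now apply is_int_pos_int_pos with l.
Qed.

(* The Euler operator [lam d/dlam + (k+1)/p] maps [model_int k] to an integral
   with amplitude supported, up to infinite order, away from 0. *)
Lemma is_derive_model_int p phi k : 0 < p ->
  exists r, (forall n b, 1 <= b -> symbol n (- 2) (INR k + b) r) /\
  forall lam, 0 < lam ->
  is_derive (model_int p phi k) lam
    (- ((INR k + 1) / p) / lam * model_int p phi k lam
     - / (lam * p) * int_pos (osc p phi lam r)).
Proof.
  intros Hp. assert (Hk := pos_INR k).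
  destruct (symbol_cutoff_derive O 1) as (d & Hd & _); [lra|].
  set (r := fun y => Rpower y (INR k + 1) * (- 1 * d y * cutoff y)).
  assert (Hr : forall n b, 1 <= b -> symbol n (- 2) (INR k + b) r).
  { intros n b Hb.
    (* The witness [d] was extracted for one fixed order; other n and b give another witness, equal
       to [d] by uniqueness of the derivative. *)
    destruct (symbol_cutoff_derive n b) as (d' & Hd' & K); [lra|].
    apply symbol_ext with (fun y => Rpower y (INR k + 1) * (- 1 * d' y * cutoff y)).
    { intros y Hy. unfold r. do 3 f_equal.
      rewrite <- (is_derive_unique _ _ _ (Hd y Hy)).
      symmetry. now apply is_derive_unique, Hd'. }
    apply symbol_between with
      (INR k + 1 + (0 + (- INR k - 3))) (INR k + 1 + (b - 1 + 0)); [lra|lra|].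
    apply symbol_mult; [apply symbol_Rpower|].
    apply symbol_mult; [now apply symbol_scal | apply symbol_cutoff; lra]. }
  exists r. split; trivial. intros lam Hlam.
  (* Differentiation under the integral sign asks for a + 2 p <= -2; the rapid decay of [cutoff]
     allows any such a. *)
  set (a := - 2 - 2 * p).
  assert (W : forall n, symbol n a (INR k) (model k)).
  { intros n. apply symbol_model. unfold a. lra. }
  assert (W1 : symbol 1 (p + a) (p + INR k) (fun y => Rpower y p * model k y)).
  { apply symbol_mult; [apply symbol_Rpower | apply W]. }
  destruct (osc_by_parts p 0 _ _ _ Hp W1) as (v & _ & Hv & IBP); [unfold a; lra|lra|].
  (* v is the derivative of y^(1-p) y^p y^k cutoff = y^(k+1) cutoff, which is where the factor k + 1
     of the Euler operator comes from. *)
  assert (Ev : forall y, 0 < y -> v y = (INR k + 1) * model k y + r y).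
  { intros y Hy. rewrite <- (is_derive_unique _ _ _ (Hv y Hy)).
    apply is_derive_unique.
    apply is_derive_ext_loc with (fun y => Rpower y (INR k + 1) * cutoff y).
    { apply locally_pos; trivial. intros z Hz. unfold model.
      rewrite <- !Rmult_assoc, <- !Rpower_plus.
      replace (1 - p + p + INR k) with (INR k + 1) by ring. trivial. }
    evar_last.
    - apply (is_derive_mult (fun y => Rpower y (INR k + 1)) cutoff).
      + now apply is_derive_Rpower.
      + now apply is_derive_cutoff, Hd.
      + intros; apply Rmult_comm.
    - unfold model, r. replace (INR k + 1 - 1) with (INR k) by ring.
      change ((INR k + 1) * Rpower y (INR k) * cutoff y
        + Rpower y (INR k + 1) * (- 1 * d y * cutoff y)
        = (INR k + 1) * (Rpower y (INR k) * cutoff y)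
        + Rpower y (INR k + 1) * (- 1 * d y * cutoff y)). ring. }
  destruct (ex_osc_int p (phi - PI / 2) lam _ _ _ _ W1) as [l Hl]; [unfold a; lra|lra|].
  destruct (IBP _ _ _ Hlam Hl) as (l' & Hl' & El).
  evar_last.
  - apply is_derive_osc_int with (5 := is_int_pos_model p phi k) (6 := Hl)
      (2 := W O); trivial. unfold a; lra.
  - destruct (ex_osc_int p phi lam r O (- 2) (INR k + 1)) as [m Hm];
      [apply Hr; lra|lra|lra|].
    apply is_int_pos_int_pos in Hm.
    (* One shift by -PI/2 comes from d/dlam, another from the integration by parts; together they
       reverse the sign of the cosine. *)
    assert (El' : l' = - 1 * ((INR k + 1) * model_int p phi k lam + int_pos (osc p phi lam r))).
    { apply is_int_pos_unique with (1 := Hl').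
      apply is_int_pos_ext with (2 := is_int_pos_scal _ (- 1) _ (is_int_pos_plus _ _ _ _
        (is_int_pos_scal _ (INR k + 1) _ (is_int_pos_model p phi k lam)) Hm)).
      intros y Hy. unfold osc. rewrite Ev by trivial.
      replace (lam * Rpower y p + (phi - PI / 2 - PI / 2))
        with (lam * Rpower y p + phi - PI) by field.
      rewrite cos_minus, cos_PI, sin_PI. ring. }
    rewrite El, El'. field. lra.
Qed.

(** In closed form, p^(-1) Gamma((k+1)/p) cos(PI (k+1) / (2p) + phi). Convergence is established
    inside [model_int_asymptotic]; until then [Lim] is only a total function. *)
Definition osc_const (p phi : R) (k : nat) : R :=
  real (Lim (fun lam => Rpower lam ((INR k + 1) / p) * model_int p phi k lam) p_infty).

Lemma model_int_asymptotic p phi k J : 0 < p ->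
  exists B, forall lam, 1 <= lam ->
    Rabs (model_int p phi k lam - osc_const p phi k * Rpower lam (- ((INR k + 1) / p)))
    <= B * Rpower lam (- INR J).
Proof.
  intros Hp. assert (Hk := pos_INR k).
  set (s := (INR k + 1) / p).
  destruct (is_derive_model_int p phi k Hp) as (r & Hr & HD).
  (* For J > s the derivative of lam^s times the model integral is O(lam^(s-1-J)), hence integrable
     at infinity. *)
  assert (W : forall J, s < INR J -> exists B, forall lam, 1 <= lam ->
    Rabs (model_int p phi k lam - osc_const p phi k * Rpower lam (- s))
    <= B * Rpower lam (- INR J)).
  { clear J. intros J HJ.
    assert (0 <= INR J * p) by (generalize (pos_INR J); nra).
    assert (R0 : symbol J (- 2) (INR k + (INR J * p + 1)) r) by (apply Hr; lra).
    destruct (osc_flat p J _ _ _ Hp R0) as [M HM]; [lra|lra|].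
    set (h := fun lam => - / p * (Rpower lam (s - 1) * int_pos (osc p phi lam r))).
    destruct (decay_limit (fun lam => Rpower lam s * model_int p phi k lam) h
      (/ p * M) (INR J - s)) as (L & HL & HB).
    - lra.
    - intros lam Hlam. evar_last.
      + apply (is_derive_mult (fun y => Rpower y s) (model_int p phi k)).
        * now apply is_derive_Rpower.
        * now apply HD.
        * intros; apply Rmult_comm.
      + change (s * Rpower lam (s - 1) * model_int p phi k lam
         + Rpower lam s * (- ((INR k + 1) / p) / lam * model_int p phi k lam
           - / (lam * p) * int_pos (osc p phi lam r)) = h lam).
        fold s. unfold h.
        replace (Rpower lam s) with (Rpower lam (s - 1) * lam).
        2: { rewrite <- (Rpower_1 lam) at 2 by trivial. rewrite <- Rpower_plus. f_equal. ring. }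
        field. lra.
    - intros lam Hlam. unfold h.
      destruct (ex_osc_int p phi lam r _ _ _ R0) as [m Hm]; [lra|lra|].
      apply is_int_pos_int_pos in Hm.
      specialize (HM phi lam _ Hlam Hm).
      rewrite !Rabs_mult, Rabs_Ropp, (Rabs_pos_eq (/ p)), (Rabs_pos_eq (Rpower lam (s - 1))).
      3: apply Rlt_le, Rinv_0_lt_compat, Hp.
      2: apply Rlt_le, Rpower_pos.
      replace (- (INR J - s) - 1) with (s - 1 + - INR J) by ring. rewrite Rpower_plus.
      replace (/ p * M * (Rpower lam (s - 1) * Rpower lam (- INR J)))
        with (/ p * (Rpower lam (s - 1) * (M * Rpower lam (- INR J)))) by ring.
      apply Rmult_le_compat_l; [apply Rlt_le, Rinv_0_lt_compat, Hp|].
      apply Rmult_le_compat_l; [apply Rlt_le, Rpower_pos|trivial].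
    - assert (EL : osc_const p phi k = L).
      { unfold osc_const. fold s. now rewrite (is_lim_unique _ _ _ HL). }
      rewrite EL. exists (/ p * M / (INR J - s)). intros lam Hlam.
      specialize (HB lam ltac:(lra)).
      replace (model_int p phi k lam - L * Rpower lam (- s))
        with (Rpower lam (- s) * (Rpower lam s * model_int p phi k lam - L)).
      2: { assert (Q : Rpower lam (- s) * Rpower lam s = 1).
           { rewrite <- Rpower_plus, Rplus_opp_l. apply Rpower_O; lra. }
           rewrite Rmult_minus_distr_l, <- Rmult_assoc, Q, Rmult_1_l.
           now rewrite (Rmult_comm L). }
      rewrite Rabs_mult, Rabs_pos_eq by apply Rlt_le, Rpower_pos.
      apply Rle_trans with (Rpower lam (- s) * (/ p * M / (INR J - s) * Rpower lam (- (INR J - s)))).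
      + apply Rmult_le_compat_l; trivial. apply Rlt_le, Rpower_pos.
      + replace (- INR J) with (- s + - (INR J - s)) by ring. rewrite (Rpower_plus (- s)).
        apply Req_le. ring. }
  (* Small values of J follow from a larger one, as lam >= 1. *)
  destruct (INR_unbounded (Rmax s (INR J))) as [J' HJ'].
  destruct (W J') as [B HB].
  - apply Rle_lt_trans with (2 := HJ'), Rmax_l.
  - exists (Rabs B). intros lam Hlam. apply Rle_trans with (1 := HB lam Hlam).
    apply Rle_trans with (Rabs B * Rpower lam (- INR J')).
    + apply Rmult_le_compat_r, Rle_abs. apply Rlt_le, Rpower_pos.
    + apply Rmult_le_compat_l; [apply Rabs_pos|]. apply Rpower_le_large; trivial.
      generalize (Rmax_r s (INR J)). lra.
Qed.

(** * Expansion for rapidly decreasing amplitudes *)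

Definition rapid (b : R -> R) : Prop :=
  forall n : nat, (forall y, ex_derive_n b n y) /\
    forall j : nat, exists M, forall y, Rabs y ^ j * Rabs (Derive_n b n y) <= M.

Lemma Derive_n_Derive b n y : Derive_n (Derive b) n y = Derive_n b (S n) y.
Proof. replace (S n) with (n + 1)%nat by lia. apply (Derive_n_comp b n 1). Qed.

Lemma ex_derive_n_Derive b n y : ex_derive_n b (S n) y -> ex_derive_n (Derive b) n y.
Proof.
  destruct n as [|n]; [easy|]. intros H.
  apply ex_derive_ext with (Derive_n b (S n)); trivial.
  intros t. now rewrite Derive_n_Derive.
Qed.

Lemma rapid_Derive b : rapid b -> rapid (Derive b).
Proof.
  intros H n. destruct (H (S n)) as [E B]. split.
  - intros y. now apply ex_derive_n_Derive.
  - intros j. destruct (B j) as [M HM]. exists M. intros y.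
    now rewrite Derive_n_Derive.
Qed.

Lemma power_bound_rapid a b : a <= 0 -> rapid b -> power_bound a b.
Proof.
  intros Ha H. destruct (H O) as [_ B].
  destruct (INR_unbounded (- a)) as [j Hj].
  apply power_bound_between with (- INR j) 0; [lra| |].
  - destruct (B j) as [M HM]. exists M. intros y Hy. specialize (HM y). cbn in HM.
    rewrite (Rabs_pos_eq y) in HM by lra.
    rewrite Rpower_Ropp, Rpower_pow by trivial.
    assert (0 < y ^ j) by now apply pow_lt.
    apply Rmult_le_reg_l with (y ^ j); trivial.
    now replace (y ^ j * (M * / y ^ j)) with M by (field; lra).
  - destruct (B O) as [M HM]. exists M. intros y Hy. specialize (HM y). cbn in HM.
    rewrite Rpower_O by trivial. lra.
Qed.

Lemma rapid_is_derive b y : rapid b -> is_derive b y (Derive b y).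
Proof. intros H. apply Derive_correct, (proj1 (H 1%nat) y). Qed.

Lemma symbol_rapid n a b : a <= 0 -> rapid b -> symbol n a 0 b.
Proof.
  revert a b. induction n as [|n IH]; intros a b Ha H; (split; [|split]);
    try (apply power_bound_rapid; trivial; lra).
  - intros y _. apply (ex_derive_continuous (V := R_NormedModule)).
    eexists; now apply rapid_is_derive.
  - exists (Derive b). split; [intros; now apply rapid_is_derive|].
    apply symbol_between with (a - 1) 0; [lra|lra|]. apply IH; [lra|].
    now apply rapid_Derive.
Qed.

(** Admits the empty sum, where the inductions on the number of Taylor terms start; [sum_n] always
    has at least one term. *)
Fixpoint psum (f : nat -> R) (n : nat) : R :=
  match n with O => 0 | S m => psum f m + f m end.

Lemma psum_sum_n f n : psum f (S n) = sum_n f n.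
Proof.
  induction n as [|n IH].
  - rewrite sum_O. apply Rplus_0_l.
  - rewrite sum_Sn, <- IH. reflexivity.
Qed.

Definition jet (b : R -> R) (k : nat) : R := Derive_n b k 0 / INR (fact k).

Definition taylor (b : R -> R) (n : nat) (y : R) : R := psum (fun k => jet b k * y ^ k) n.

Lemma is_derive_taylor b n y : is_derive (taylor b (S n)) y (taylor (Derive b) n y).
Proof.
  unfold taylor. induction n as [|n IH].
  - cbn. apply is_derive_ext with (fun _ => jet b 0).
    + intros t. apply eq_sym. ring_simplify. trivial.
    + apply (is_derive_const (V := R_NormedModule)).
  - apply is_derive_ext with
      (fun y => psum (fun k => jet b k * y ^ k) (S n) + jet b (S n) * y ^ S n); [easy|].
    apply (is_derive_plus (V := R_NormedModule)); trivial.
    evar_last.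
    + apply is_derive_scal, (is_derive_pow (fun x => x)), (is_derive_id (K := R_AbsRing)).
    + unfold jet. rewrite Derive_n_Derive. cbn [pred]. rewrite fact_simpl, mult_INR.
      change (Derive_n b (S n) 0 / (INR (S n) * INR (fact n)) * (INR (S n) * 1 * y ^ n) =
        Derive_n b (S n) 0 / INR (fact n) * y ^ n).
      field. split; [apply INR_fact_neq_0 | now apply not_0_INR].
Qed.

Lemma taylor_sum b n y :
  taylor b (S n) y = sum_f_R0 (fun m => (y - 0) ^ m / INR (fact m) * Derive_n b m 0) n.
Proof.
  unfold taylor. rewrite psum_sum_n, sum_n_Reals. apply sum_eq. intros i _.
  unfold jet. rewrite Rminus_0_r. field. apply INR_fact_neq_0.
Qed.

Lemma power_bound_taylor n b : rapid b -> power_bound (INR n) (fun y => b y - taylor b n y).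
Proof.
  intros H. destruct n as [|n].
  - apply power_bound_ext with b; [intros; unfold taylor; cbn; ring|].
    apply power_bound_rapid; trivial. cbn. lra.
  - destruct (proj2 (H (S n)) O) as [M HM].
    exists (/ INR (fact (S n)) * M). intros y Hy.
    destruct (Taylor_Lagrange b n 0 y Hy) as (z & _ & ->).
    { intros t _ k _. apply H. }
    rewrite taylor_sum.
    assert (F : 0 < INR (fact (S n))) by apply INR_fact_lt_0.
    rewrite Rpower_pow, Rplus_minus_l, Rminus_0_r by trivial.
    assert (P : 0 < y ^ S n) by now apply pow_lt.
    rewrite Rabs_mult, Rabs_pos_eq.
    2: apply Rlt_le, Rdiv_lt_0_compat; trivial.
    specialize (HM z). cbn [pow] in HM. rewrite Rmult_1_l in HM.
    replace (/ INR (fact (S n)) * M * y ^ S n) with (y ^ S n / INR (fact (S n)) * M)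
      by (field; lra).
    apply Rmult_le_compat_l; trivial. apply Rlt_le, Rdiv_lt_0_compat; trivial.
Qed.

(** This is the bound that serves at infinity, where the Taylor polynomial of degree n - 1
    dominates. It comes from [power_bound_taylor] one order lower by peeling off the last
    monomial. *)
Lemma power_bound_taylor_pred n b : rapid b ->
  power_bound (INR n - 1) (fun y => b y - taylor b n y).
Proof.
  intros H. destruct n as [|n].
  - apply power_bound_ext with b; [intros; unfold taylor; cbn; ring|].
    apply power_bound_rapid; trivial. cbn. lra.
  - rewrite S_INR. replace (INR n + 1 - 1) with (INR n) by ring.
    apply power_bound_ext with (fun y => (b y - taylor b n y) + (- jet b n) * y ^ n).
    { intros y _. unfold taylor. cbn. ring. }
    apply power_bound_plus; [now apply power_bound_taylor|].
    exists (Rabs (- jet b n)). intros y Hy. rewrite Rpower_pow, Rabs_mult by trivial.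
    apply Req_le. f_equal. apply Rabs_pos_eq, Rlt_le, pow_lt, Hy.
Qed.

(** Differentiation sends the remainder of b after n terms to that of b' after n - 1 terms, so both
    exponents drop by one as a symbol demands; once no term is left, the function itself is rapidly
    decreasing. *)
Lemma symbol_taylor m n b : rapid b ->
  symbol m (INR n - 1) (INR n) (fun y => b y - taylor b n y).
Proof.
  assert (D : forall b n y, rapid b ->
    is_derive (fun y => b y - taylor b (S n) y) y (Derive b y - taylor (Derive b) n y)).
  { clear. intros b n y H. apply (is_derive_minus (V := R_NormedModule)).
    - now apply rapid_is_derive.
    - apply is_derive_taylor. }
  assert (Z : forall m b, rapid b -> symbol m (INR 0 - 1) (INR 0) (fun y => b y - taylor b 0 y)).
  { clear. intros m b H. apply symbol_ext with b; [intros; unfold taylor; cbn; ring|].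
    apply symbol_rapid; trivial. cbn; lra. }
  revert n b. induction m as [|m IH]; intros [|n] b H; try now apply Z.
  all: split; [|split]; try (now apply power_bound_taylor); try now apply power_bound_taylor_pred.
  - intros y _. apply (ex_derive_continuous (K := R_AbsRing) (V := R_NormedModule)
      (fun y => b y - taylor b (S n) y)). eexists; now apply D.
  - exists (fun y => Derive b y - taylor (Derive b) n y). split; [intros; now apply D|].
    rewrite S_INR. replace (INR n + 1 - 1) with (INR n) by ring.
    apply IH. now apply rapid_Derive.
Qed.

(** The bound holds on all of [1, oo) rather than near infinity, so sums and multiples involve no
    thresholds. *)
Definition bO (e : R) (f : R -> R) : Prop :=
  exists C, forall lam, 1 <= lam -> Rabs (f lam) <= C * Rpower lam e.

Lemma bO_ext e f g : (forall lam, 1 <= lam -> f lam = g lam) -> bO e f -> bO e g.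
Proof.
  intros E [C H]. exists C. intros lam Hl. rewrite <- E by trivial. now apply H.
Qed.

Lemma bO_plus e f g : bO e f -> bO e g -> bO e (fun lam => f lam + g lam).
Proof.
  intros [C H] [D K]. exists (C + D). intros lam Hl.
  apply Rle_trans with (1 := Rabs_triang _ _).
  specialize (H lam Hl). specialize (K lam Hl). lra.
Qed.

Lemma bO_scal e c f : bO e f -> bO e (fun lam => c * f lam).
Proof.
  intros [C H]. exists (Rabs c * C). intros lam Hl. rewrite Rabs_mult, Rmult_assoc.
  apply Rmult_le_compat_l; auto using Rabs_pos.
Qed.

Lemma bO_weaken e e' f : e <= e' -> bO e f -> bO e' f.
Proof.
  intros He [C H]. exists (Rabs C). intros lam Hl. apply Rle_trans with (1 := H lam Hl).
  apply Rle_trans with (Rabs C * Rpower lam e).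
  - apply Rmult_le_compat_r, Rle_abs. apply Rlt_le, Rpower_pos.
  - apply Rmult_le_compat_l; [apply Rabs_pos|]. now apply Rpower_le_large.
Qed.

Lemma bO_Rpower e : bO e (fun lam => Rpower lam e).
Proof.
  exists 1. intros lam _. rewrite Rabs_pos_eq; [lra|]. apply Rlt_le, Rpower_pos.
Qed.

Lemma is_int_pos_rapid p phi lam k b : rapid b ->
  is_int_pos (osc p phi lam (fun y => y ^ k * b y))
    (int_pos (osc p phi lam (fun y => y ^ k * b y))).
Proof.
  intros H.
  assert (W : symbol 0 (INR k + (- 2 - INR k)) (INR k + 0) (fun y => y ^ k * b y)).
  { apply symbol_mult; [apply symbol_pow|]. apply symbol_rapid; trivial.
    generalize (pos_INR k). lra. }
  destruct (ex_osc_int p phi lam _ _ _ _ W) as [l Hl].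
  - lra.
  - generalize (pos_INR k). lra.
  - now apply is_int_pos_int_pos with l.
Qed.

Lemma is_int_pos_psum (f : nat -> R -> R) (l : nat -> R) n :
  (forall j, is_int_pos (f j) (l j)) ->
  is_int_pos (fun y => psum (fun j => f j y) n) (psum l n).
Proof.
  intros H. induction n as [|n IH].
  - apply is_int_pos_ext with (fun y => 0 * f O y).
    { intros; cbn; ring. }
    assert (X := is_int_pos_scal _ 0 _ (H O)). now rewrite Rmult_0_l in X.
  - cbn. now apply is_int_pos_plus.
Qed.

(** The monomial y^k is kept apart from b because the result is used twice: with general k and one
    term for the regularized integrals, and with k = 0 for the expansion of the theorem. *)
Lemma rapid_expansion p phi k b N : 0 < p -> rapid b ->
  bO (- ((INR (k + N) + 1) / p))
    (fun lam => int_pos (osc p phi lam (fun y => y ^ k * b y))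
      - psum (fun j => jet b j * osc_const p phi (k + j)
                       * Rpower lam (- ((INR (k + j) + 1) / p))) N).
Proof.
  intros Hp Hb.
  set (e := (INR (k + N) + 1) / p).
  (* [J] puts lam^(-J) within the error lam^(-e), and [d] makes M = N + d at least J p, so that the
     remainder after M terms admits J integrations by parts. *)
  destruct (INR_unbounded e) as [J HJ].
  destruct (INR_unbounded (INR J * p)) as [d Hd].
  set (M := (N + d)%nat).
  assert (HM : INR J * p <= INR M).
  { unfold M. rewrite plus_INR. generalize (pos_INR N). lra. }
  assert (Hk := pos_INR k). assert (HMp := pos_INR M).
  (* w is y^k b minus the cut-off Taylor part y^k T_M cutoff. Its first summand vanishes to high
     order at 0 through the Taylor remainder, its second through 1 - cutoff; both decay at
     infinity. *)
  set (w := fun y => y ^ k * (b y - taylor b M y) * cutoff y + y ^ k * b y * (1 - cutoff y)).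
  assert (W : symbol J (- 2) (INR M) w).
  { apply symbol_plus.
    - apply symbol_between with
        (INR k + (INR M - 1) + (- INR k - INR M - 1)) (INR k + INR M + 0); [lra|lra|].
      apply symbol_mult; [|apply symbol_cutoff; lra].
      apply symbol_mult; [apply symbol_pow | now apply symbol_taylor].
    - apply symbol_between with (INR k + (- 2 - INR k) + 0) (INR k + 0 + INR M); [lra|lra|].
      apply symbol_mult; [|apply symbol_one_minus_cutoff; lra].
      apply symbol_mult; [apply symbol_pow | apply symbol_rapid; trivial; lra]. }
  destruct (osc_flat p J _ _ _ Hp W) as [C HC]; [lra|trivial|].
  assert (Ow : bO (- e) (fun lam => int_pos (osc p phi lam w))).
  { apply bO_weaken with (- INR J); [lra|]. exists C. intros lam Hlam.
    apply HC with phi; [lra|].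
    destruct (ex_osc_int p phi lam _ _ _ _ W) as [l Hl]; [lra|lra|].
    now apply is_int_pos_int_pos with l. }
  assert (Om : forall j, bO (- e) (fun lam => model_int p phi (k + j) lam
    - osc_const p phi (k + j) * Rpower lam (- ((INR (k + j) + 1) / p)))).
  { intros j. apply bO_weaken with (- INR J); [lra|]. exact (model_int_asymptotic p phi (k + j) J Hp). }
  (* The d additional Taylor terms have index at least N, so each one is itself O(lam^(-e)). *)
  assert (Os : bO (- e) (fun lam => psum (fun j => jet b j * model_int p phi (k + j) lam) M
    - psum (fun j => jet b j * osc_const p phi (k + j)
                       * Rpower lam (- ((INR (k + j) + 1) / p))) N)).
  { unfold M. clear - Om Hp. induction d as [|d IH].
    - rewrite Nat.add_0_r. unfold e in *. clear e. revert Om.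
      generalize (- ((INR (k + N) + 1) / p)). intros e Om.
      induction N as [|N IH]; cbn [psum].
      + apply bO_ext with (fun lam => 0 * Rpower lam e); [intros; ring|].
        apply bO_scal, bO_Rpower.
      + apply bO_ext with (2 := bO_plus _ _ _ IH (bO_scal _ (jet b N) _ (Om N))).
        intros; ring.
    - rewrite Nat.add_succ_r. cbn [psum].
      assert (X : bO (- e) (fun lam => Rpower lam (- ((INR (k + (N + d)) + 1) / p)))).
      { apply bO_weaken with (2 := bO_Rpower _).
        apply Ropp_le_contravar. unfold e. apply Rmult_le_compat_r.
        - apply Rlt_le, Rinv_0_lt_compat, Hp.
        - rewrite !plus_INR. generalize (pos_INR d). lra. }
      apply bO_ext with (2 := bO_plus _ _ _ IH (bO_plus _ _ _
        (bO_scal _ (jet b (N + d)) _ (Om (N + d)%nat))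
        (bO_scal _ (jet b (N + d) * osc_const p phi (k + (N + d))) _ X))).
      intros; ring. }
  apply bO_ext with (2 := bO_plus _ _ _ Ow Os). intros lam Hlam.
  assert (E : int_pos (osc p phi lam (fun y => y ^ k * b y))
    = int_pos (osc p phi lam w) + psum (fun j => jet b j * model_int p phi (k + j) lam) M).
  { apply is_int_pos_unique with (1 := is_int_pos_rapid p phi lam k b Hb).
    destruct (ex_osc_int p phi lam _ _ _ _ W) as [l Hl]; [lra|lra|].
    apply is_int_pos_int_pos in Hl.
    assert (S := is_int_pos_psum (fun j y => jet b j * osc p phi lam (model (k + j)) y) 
      (fun j => jet b j * model_int p phi (k + j) lam) M
      (fun j => is_int_pos_scal _ (jet b j) _ (is_int_pos_model p phi (k + j) lam))).
    apply is_int_pos_ext with (2 := is_int_pos_plus _ _ _ _ Hl S).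
    intros y Hy.
    assert (T : forall n, psum (fun j => jet b j * osc p phi lam (model (k + j)) y) n
      = osc p phi lam (fun y => y ^ k * taylor b n y * cutoff y) y).
    { unfold taylor. induction n as [|n IH]; cbn [psum].
      - unfold osc. ring.
      - rewrite IH. unfold osc, model. rewrite Rpower_pow, pow_add by trivial. ring. }
    rewrite T. unfold osc, w. ring. }
  rewrite E. ring.
Qed.

(** * Complex half-line integrals and the oscillatory constants *)

Lemma is_RInt_gen_C (Fa Fb : (R -> Prop) -> Prop) (f : R -> C) (l : C) :
  Filter Fa -> Filter Fb ->
  is_RInt_gen (fun t => Re (f t)) Fa Fb (Re l) ->
  is_RInt_gen (fun t => Im (f t)) Fa Fb (Im l) ->
  is_RInt_gen (V := C_R_NormedModule) f Fa Fb l.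
Proof.
  intros FFa FFb H1 H2 P [eps HP].
  assert (K1 := H1 _ (locally_ball (Re l) eps)).
  assert (K2 := H2 _ (locally_ball (Im l) eps)).
  unfold filtermapi in K1, K2 |- *. generalize (filter_and _ _ K1 K2). apply filter_imp.
  intros ab [(I1 & R1 & B1) (I2 & R2 & B2)].
  exists (I1, I2). split.
  - apply (is_RInt_fct_extend_pair (U := R_NormedModule) (V := R_NormedModule) f); trivial.
  - apply HP. split; trivial.
Qed.

(** Replaces the limit at the lower endpoint by the point 0, as [CInt_half] has it: continuity at 0
    makes the integral over [0, a] vanish with a. *)
Lemma is_RInt_gen_at_point_0 (g : R -> R) l :
  (forall y, continuous g y) -> is_int_pos g l ->
  is_RInt_gen g (at_point 0) (Rbar_locally p_infty) l.
Proof.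
  intros Hc Hl P [eps HP].
  assert (ER : forall a b, ex_RInt g a b).
  { intros a b. apply (ex_RInt_continuous (V := R_CompleteNormedModule)). intros; apply Hc. }
  assert (L0 : filterlim (RInt g 0) (at_right 0) (locally 0)).
  { eapply filterlim_filter_le_1; [apply filter_le_within|].
    assert (Q : continuous (RInt g 0) 0).
    { apply (ex_derive_continuous (K := R_AbsRing) (V := R_NormedModule) (RInt g 0)).
      exists (g 0). apply (is_derive_RInt (V := R_NormedModule) g (RInt g 0) 0 0); [|apply Hc].
      exists (mkposreal 1 Rlt_0_1). intros y _.
      apply (RInt_correct (V := R_CompleteNormedModule)), ER. }
    unfold continuous in Q.
    now rewrite (RInt_point (V := R_CompleteNormedModule)) in Q. }
  specialize (Hl _ (locally_ball l (pos_div_2 eps))).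
  destruct Hl as [Q1 Q2 H1 H2 H].
  assert (K := proj1 (filterlim_locally _ _) L0 (pos_div_2 eps)).
  destruct (filter_ex (F := at_right 0) _ (filter_and _ _ H1 K)) as (a & Ha & Ka).
  apply Filter_prod with (fun x => x = 0) Q2; [easy|trivial|].
  intros x b -> Hb. cbn [fst snd]. destruct (H a b Ha Hb) as (I & HI & BI).
  cbn [fst snd] in HI. exists (RInt g 0 b). split.
  - apply (RInt_correct (V := R_CompleteNormedModule)), ER.
  - apply HP. rewrite <- (RInt_Chasles (V := R_CompleteNormedModule) g 0 a b) by apply ER.
    rewrite (is_RInt_unique (V := R_CompleteNormedModule) _ _ _ _ HI).
    change (Rabs (RInt g 0 a + I - l) < eps).
    change (Rabs (RInt g 0 a - 0) < eps / 2) in Ka. change (Rabs (I - l) < eps / 2) in BI.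
    rewrite Rminus_0_r in Ka.
    replace (RInt g 0 a + I - l) with (RInt g 0 a + (I - l)) by ring.
    apply Rle_lt_trans with (1 := Rabs_triang _ _). lra.
Qed.

Lemma is_RInt_gen_dilate (V : NormedModule R_AbsRing) (f : R -> V) c l : 0 < c ->
  is_RInt_gen f (at_point 0) (Rbar_locally p_infty) l ->
  is_RInt_gen (fun x => scal c (f (c * x))) (at_point 0) (Rbar_locally p_infty) l.
Proof.
  intros Hc Hl P HP. specialize (Hl P HP). destruct Hl as [Q1 Q2 H1 [X H2] H].
  apply Filter_prod with (fun x => x = 0) (fun b => X / c < b); [easy|now exists (X / c)|].
  intros x b -> Hb. cbn [fst snd].
  destruct (H 0 (c * b) H1) as (I & HI & PI).
  { apply H2. apply Rmult_lt_reg_l with (/ c); [now apply Rinv_0_lt_compat|].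
    replace (/ c * (c * b)) with b by (field; lra).
    replace (/ c * X) with (X / c) by (field; lra). trivial. }
  exists I. split; trivial. cbn [fst snd] in HI.
  apply (is_RInt_ext (fun x => scal c (f (c * x + 0)))).
  { intros z _. now rewrite Rplus_0_r. }
  apply is_RInt_comp_lin. now rewrite Rmult_0_r, !Rplus_0_r.
Qed.

Lemma rpow_pos x p : 0 < x -> rpow x p = Rpower x p.
Proof. intros H. unfold rpow. destruct Rlt_dec; [trivial|lra]. Qed.

Lemma rpow_nonpos x p : x <= 0 -> rpow x p = 0.
Proof. intros H. unfold rpow. destruct Rlt_dec; [lra|trivial]. Qed.

Lemma rpow_continuous p x : 0 < p -> continuous (fun y => rpow y p) x.
Proof.
  intros Hp. destruct (Rtotal_order x 0) as [H|[->|H]].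
  - apply continuous_ext_loc with (fun _ => 0); [|apply continuous_const].
    generalize (open_lt 0 x H). apply filter_imp. intros z Hz. now rewrite rpow_nonpos by lra.
  - apply filterlim_locally. intros eps.
    exists (mkposreal _ (Rpower_pos eps (/ p))). intros y Hy.
    change (Rabs (y - 0) < Rpower eps (/ p)) in Hy. rewrite Rminus_0_r in Hy.
    change (Rabs (rpow y p - rpow 0 p) < eps).
    rewrite (rpow_nonpos 0), Rminus_0_r by lra.
    destruct (Rlt_dec 0 y) as [h|h].
    + rewrite rpow_pos by trivial. rewrite Rabs_pos_eq by apply Rlt_le, Rpower_pos.
      rewrite Rabs_pos_eq in Hy by lra.
      replace (pos eps) with (Rpower (Rpower eps (/ p)) p).
      * apply Rlt_Rpower_l; lra.
      * rewrite Rpower_mult, Rinv_l, Rpower_1; [trivial|apply cond_pos|lra].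
    + rewrite rpow_nonpos, Rabs_R0 by lra. apply cond_pos.
  - apply continuous_ext_loc with (fun y => Rpower y p).
    + apply locally_pos; trivial. intros z Hz. now rewrite rpow_pos.
    + apply (ex_derive_continuous (K := R_AbsRing) (V := R_NormedModule)
        (fun y => Rpower y p)). eexists; now apply is_derive_Rpower.
Qed.

Lemma rpow_dilate c x p : 0 < c -> rpow (c * x) p = Rpower c p * rpow x p.
Proof.
  intros Hc. destruct (Rlt_dec 0 x) as [h|h].
  - rewrite !rpow_pos by nra. rewrite <- Rpower_mult_distr; trivial.
  - rewrite !rpow_nonpos by nra. ring.
Qed.

Lemma CInt_half_unique (f : R -> C) (l : C) :
  is_RInt_gen (V := C_R_NormedModule) f (at_point 0) (Rbar_locally p_infty) l ->
  CInt_half f = l.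
Proof. exact (is_RInt_gen_unique (V := C_R_CompleteNormedModule) f l). Qed.

Definition crapid (B : R -> C) : Prop :=
  rapid (fun t => Re (B t)) /\ rapid (fun t => Im (B t)).

Definition osc_rapid (p phi : R) (k : nat) (b : R -> R) (lam : R) : R :=
  int_pos (osc p phi lam (fun y => y ^ k * b y)).

(* The integral of [e^(s i lam y^p) y^k B(y)] over (0, oo): since s = 1 or -1, the
   sine of the phase is [s * cos (lam y^p - PI / 2)]. *)
Definition half_line (s p : R) (k : nat) (B : R -> C) (lam : R) : C :=
  (osc_rapid p 0 k (fun t => Re (B t)) lam - s * osc_rapid p (0 - PI / 2) k (fun t => Im (B t)) lam,
   osc_rapid p 0 k (fun t => Im (B t)) lam + s * osc_rapid p (0 - PI / 2) k (fun t => Re (B t)) lam).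

Lemma rapid_continuous b y : rapid b -> continuous b y.
Proof.
  intros H. apply (ex_derive_continuous (V := R_NormedModule)).
  eexists; now apply rapid_is_derive.
Qed.

Lemma pow_continuous k y : continuous (fun y => y ^ k) y.
Proof.
  apply (ex_derive_continuous (K := R_AbsRing) (V := R_NormedModule) (fun y => y ^ k)).
  auto_derive. trivial.
Qed.

Lemma Re_expi_mult a (z : C) : Re (expi a * z) = cos a * Re z - sin a * Im z.
Proof. reflexivity. Qed.

Lemma Im_expi_mult a (z : C) : Im (expi a * z) = cos a * Im z + sin a * Re z.
Proof. reflexivity. Qed.

Lemma is_RInt_gen_half_line s p k B lam : s = 1 \/ s = - 1 -> 0 < p -> crapid B ->
  is_RInt_gen (V := C_R_NormedModule)
    (fun y => (expi (s * (lam * rpow y p)) * (RtoC (y ^ k) * B y))%C)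
    (at_point 0) (Rbar_locally p_infty) (half_line s p k B lam).
Proof.
  intros Hs Hp [H1 H2].
  assert (Cc : forall y, continuous (fun y => cos (s * (lam * rpow y p))) y).
  { intros y. apply continuous_cos_comp, (continuous_scal_r (V := R_NormedModule)).
    apply (continuous_scal_r (V := R_NormedModule)). now apply rpow_continuous. }
  assert (Cs : forall y, continuous (fun y => sin (s * (lam * rpow y p))) y).
  { intros y. apply continuous_sin_comp, (continuous_scal_r (V := R_NormedModule)).
    apply (continuous_scal_r (V := R_NormedModule)). now apply rpow_continuous. }
  assert (Cb : forall b y, rapid b -> continuous (fun y => y ^ k * b y) y).
  { intros b y Hb. apply (continuous_mult (K := R_AbsRing)).
    - apply pow_continuous.
    - now apply rapid_continuous. }
  assert (Ecos : forall y, 0 < y ->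
    cos (s * (lam * rpow y p)) = cos (lam * Rpower y p)).
  { intros y Hy. rewrite rpow_pos by trivial. destruct Hs as [->| ->].
    - now rewrite Rmult_1_l.
    - rewrite <- cos_neg. f_equal. ring. }
  assert (Esin : forall y, 0 < y ->
    sin (s * (lam * rpow y p)) = s * sin (lam * Rpower y p)).
  { intros y Hy. rewrite rpow_pos by trivial. destruct Hs as [->| ->].
    - now rewrite !Rmult_1_l.
    - replace (-1 * (lam * Rpower y p)) with (- (lam * Rpower y p)) by ring.
      rewrite sin_neg. ring. }
  assert (G : forall c b1 b2, rapid b1 -> rapid b2 ->
    is_RInt_gen (fun y => cos (s * (lam * rpow y p)) * (y ^ k * b1 y)
      + c * (sin (s * (lam * rpow y p)) * (y ^ k * b2 y)))
     (at_point 0) (Rbar_locally p_infty)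
     (osc_rapid p 0 k b1 lam + c * s * osc_rapid p (0 - PI / 2) k b2 lam)).
  { intros c b1 b2 R1 R2. apply is_RInt_gen_at_point_0.
    - intros y. apply (continuous_plus (V := R_NormedModule)).
      + apply (continuous_mult (K := R_AbsRing)); auto.
      + apply (continuous_scal_r (V := R_NormedModule)).
        apply (continuous_mult (K := R_AbsRing)); auto.
    - apply is_int_pos_ext with (2 := is_int_pos_plus _ _ _ _
        (is_int_pos_rapid p 0 lam k b1 R1)
        (is_int_pos_scal _ (c * s) _ (is_int_pos_rapid p (0 - PI / 2) lam k b2 R2))).
      intros y Hy. rewrite Ecos, Esin, osc_sin by trivial. unfold osc.
      rewrite !Rplus_0_r. ring. }
  apply is_RInt_gen_C; try apply _.
  - replace (Re (half_line s p k B lam)) with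
      (osc_rapid p 0 k (fun t => Re (B t)) lam
       + - 1 * s * osc_rapid p (0 - PI / 2) k (fun t => Im (B t)) lam)
      by (cbn; ring).
    refine (is_RInt_gen_ext _ _ _ _ (G (- 1) _ _ H1 H2)).
    apply filter_forall. intros ab y _. rewrite Re_expi_mult. cbn. unfold Re, Im. ring.
  - replace (Im (half_line s p k B lam)) with
      (osc_rapid p 0 k (fun t => Im (B t)) lam
       + 1 * s * osc_rapid p (0 - PI / 2) k (fun t => Re (B t)) lam)
      by (cbn; ring).
    refine (is_RInt_gen_ext _ _ _ _ (G 1 _ _ H2 H1)).
    apply filter_forall. intros ab y _. rewrite Im_expi_mult. cbn. unfold Re, Im. ring.
Qed.

Definition os_value (s p : R) (k : nat) : C :=
  (osc_const p 0 k, s * osc_const p (0 - PI / 2) k).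

Lemma rapid_schwartz chi : schwartz chi -> crapid chi.
Proof.
  intros [S D]. split; intros n; split; try (intros y; apply S);
    intros j; destruct (D j n) as [M HM]; exists M; intros y;
    apply Rle_trans with (2 := HM y);
    apply Rmult_le_compat_l; try (apply pow_le, Rabs_pos).
  - apply (re_le_Cmod (CDerive_n chi n y)).
  - apply Rle_trans with (2 := Rmax_Cmod (CDerive_n chi n y)), Rmax_r.
Qed.

(** The one-term expansion at lam = eps^(-p), where lam^(-r/p) becomes eps^r; the remainder is one
    power further and leaves a factor eps. *)
Lemma osc_rapid_leading p phi k b : 0 < p -> rapid b ->
  exists M, forall eps, 0 < eps <= 1 ->
  Rabs (/ eps ^ (k + 1) * osc_rapid p phi k b (Rpower eps (- p)) - b 0 * osc_const p phi k)
  <= M * eps.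
Proof.
  intros Hp Hb.
  destruct (rapid_expansion p phi k b 1 Hp Hb) as [M HM].
  exists M. intros eps He.
  assert (E : forall r, Rpower (Rpower eps (- p)) (- (r / p)) = Rpower eps r).
  { intros r. rewrite Rpower_mult. f_equal. field. lra. }
  assert (Hl : 1 <= Rpower eps (- p)).
  { rewrite <- (Rpower_O eps) by lra. apply Rpower_le_small; lra. }
  specialize (HM _ Hl). cbn [psum] in HM. rewrite !E in HM.
  unfold jet in HM. cbn [Derive_n fact] in HM.
  fold (osc_rapid p phi k b (Rpower eps (- p))) in HM.
  rewrite Nat.add_0_r in HM.
  replace (INR k + 1) with (INR (k + 1)) in HM by (rewrite plus_INR; simpl; ring).
  replace (INR (k + 1) + 1) with (INR (k + 1 + 1)) in HM by (rewrite (plus_INR (k + 1)); simpl; ring).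
  rewrite !Rpower_pow in HM by lra.
  assert (P : 0 < eps ^ (k + 1)) by (apply pow_lt; lra).
  apply Rmult_le_reg_l with (1 := P).
  rewrite <- (Rabs_pos_eq (eps ^ (k + 1))) at 1 by lra.
  rewrite <- Rabs_mult.
  replace (eps ^ (k + 1) * (M * eps)) with (M * eps ^ (k + 1 + 1)).
  2: { rewrite (pow_add eps (k + 1) 1). ring. }
  apply Rle_trans with (2 := HM). apply Req_le. f_equal. cbn [INR].
  field. lra.
Qed.

Lemma is_Os_int_os_value s p k : s = 1 \/ s = - 1 -> 0 < p ->
  is_Os_int (fun x => (expi (s * rpow x p) * RtoC (x ^ k))%C) (os_value s p k).
Proof.
  intros Hs Hp chi Hchi Hchi0.
  assert (CR := rapid_schwartz chi Hchi). destruct (CR) as [R1 R2].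
  (* Substituting x = y / eps turns x^p into eps^(-p) y^p; dx contributes eps^(-1) and x^k
     contributes eps^(-k). *)
  set (v := fun eps => let z := half_line s p k chi (Rpower eps (- p)) in
    (/ eps ^ (k + 1) * Re z, / eps ^ (k + 1) * Im z) : C).
  apply filterlim_ext_loc with v.
  { exists (mkposreal 1 Rlt_0_1). intros eps _ He. symmetry.
    apply CInt_half_unique.
    assert (K := is_RInt_gen_half_line s p k chi (Rpower eps (- p)) Hs Hp CR).
    apply (is_RInt_gen_dilate _ _ eps _ He) in K.
    apply (is_RInt_gen_scal (V := C_R_NormedModule) _ (/ eps ^ (k + 1))) in K.
    refine (is_RInt_gen_ext _ _ _ _ K).
    apply filter_forall. intros ab y _.
    rewrite rpow_dilate by trivial.
    replace (s * (Rpower eps (- p) * (Rpower eps p * rpow y p))) with (s * rpow y p).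
    2: { rewrite <- (Rmult_assoc (Rpower _ _)), <- Rpower_plus, Rplus_opp_l, Rpower_O by trivial.
         ring. }
    assert (Q : eps ^ k <> 0) by (apply pow_nonzero; lra).
    rewrite Rpow_mult_distr, pow_add.
    destruct (chi (eps * y)) as [u1 u2].
    unfold scal, Cmult, expi, RtoC; cbn. unfold prod_scal, scal, mult; cbn.
    f_equal; field; split; trivial; lra. }
  destruct (osc_rapid_leading p 0 k _ Hp R1) as [M1 HM1].
  destruct (osc_rapid_leading p 0 k _ Hp R2) as [M2 HM2].
  destruct (osc_rapid_leading p (0 - PI / 2) k _ Hp R1) as [M3 HM3].
  destruct (osc_rapid_leading p (0 - PI / 2) k _ Hp R2) as [M4 HM4].
  (* Since chi 0 = 1 has imaginary part 0, each component of the limit keeps one of its two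
     contributions and the other tends to 0. *)
  rewrite Hchi0 in HM1, HM2, HM3, HM4.
  change (Re 1%C) with 1 in HM1, HM3. change (Im 1%C) with 0 in HM2, HM4.
  assert (Hs1 : Rabs s = 1).
  { destruct Hs as [->| ->]; [apply Rabs_R1|].
    rewrite Rabs_left; lra. }
  apply filterlim_locally. intros d.
  set (M := Rabs M1 + Rabs M2 + Rabs M3 + Rabs M4 + 1).
  assert (HM : 0 < M).
  { unfold M. generalize (Rabs_pos M1) (Rabs_pos M2) (Rabs_pos M3) (Rabs_pos M4). lra. }
  assert (Hd : 0 < Rmin 1 (d / M)).
  { apply Rmin_glb_lt; [lra|]. apply Rdiv_lt_0_compat; trivial. apply cond_pos. }
  exists (mkposreal _ Hd). intros eps Heps He.
  change (Rabs (eps - 0) < Rmin 1 (d / M)) in Heps.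
  rewrite Rminus_0_r, Rabs_pos_eq in Heps by lra.
  assert (He1 : 0 < eps <= 1).
  { split; trivial. apply Rlt_le, Rlt_le_trans with (1 := Heps), Rmin_l. }
  assert (Hed : M * eps < d).
  { replace (pos d) with (M * (d / M)) by (field; lra).
    apply Rmult_lt_compat_l; trivial. apply Rlt_le_trans with (1 := Heps), Rmin_r. }
  specialize (HM1 eps He1). specialize (HM2 eps He1).
  specialize (HM3 eps He1). specialize (HM4 eps He1).
  assert (A : forall A1 A2 u u2 c z, Rabs u <= A1 * eps -> Rabs u2 <= A2 * eps ->
    A1 + A2 <= M -> Rabs c = 1 -> z = u + c * u2 -> Rabs z < d).
  { intros A1 A2 u u2 c z Hu Hv HA Hc ->. apply Rle_lt_trans with (2 := Hed).
    apply Rle_trans with (1 := Rabs_triang _ _).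
    rewrite Rabs_mult, Hc. apply Rle_trans with ((A1 + A2) * eps); [lra|].
    apply Rmult_le_compat_r; lra. }
  assert (LM := (Rle_abs M1, Rle_abs M2, Rle_abs M3, Rle_abs M4,
    Rabs_pos M1, Rabs_pos M2, Rabs_pos M3, Rabs_pos M4)).
  decompose [prod] LM. clear LM.
  set (lam := Rpower eps (- p)) in *.
  split.
  - change (Rabs (/ eps ^ (k + 1) * (osc_rapid p 0 k (fun t => Re (chi t)) lam
      - s * osc_rapid p (0 - PI / 2) k (fun t => Im (chi t)) lam) - osc_const p 0 k) < d).
    apply (A M1 M4 _ _ (- s) _ HM1 HM4); [unfold M; lra|now rewrite Rabs_Ropp|ring].
  - change (Rabs (/ eps ^ (k + 1) * (osc_rapid p 0 k (fun t => Im (chi t)) lam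
      + s * osc_rapid p (0 - PI / 2) k (fun t => Re (chi t)) lam)
      - s * osc_const p (0 - PI / 2) k) < d).
    apply (A M2 M3 _ _ s _ HM2 HM3); [unfold M; lra|trivial|ring].
Qed.

(** * A Gaussian regularizer and the value of the oscillatory integral *)

Lemma rapid_of_class (F : (R -> R) -> Prop) :
  (forall f, F f -> exists f', F f' /\ forall y, is_derive f y (f' y)) ->
  (forall f j, F f -> exists M, forall y, Rabs y ^ j * Rabs (f y) <= M) ->
  forall f, F f -> rapid f.
Proof.
  intros HD HB f Hf n.
  assert (E : exists g, F g /\ (forall y, Derive_n f n y = g y) /\ forall y, ex_derive_n f n y).
  { induction n as [|n (g & Fg & Eg & _)].
    - now exists f.
    - destruct (HD g Fg) as (g' & Fg' & Dg). exists g'. split; [|split]; trivial; intros y.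
      + cbn. rewrite (Derive_ext _ g) by trivial. now apply is_derive_unique.
      + cbn. apply ex_derive_ext with g; [easy|]. now exists (g' y). }
  destruct E as (g & Fg & Eg & Ex). split; trivial.
  intros j. destruct (HB g j Fg) as [M HM]. exists M. intros y. now rewrite Eg.
Qed.

(** The polynomial multiples of the Gaussian, generated so that the derivative of a member is
    visibly a member; [rapid_of_class] then handles all orders at once, without Hermite
    polynomials. *)
Inductive gauss_class : (R -> R) -> Prop :=
  | gauss_mono k : gauss_class (fun x => x ^ k * exp (- x ^ 2))
  | gauss_plus f g : gauss_class f -> gauss_class g -> gauss_class (fun x => f x + g x)
  | gauss_scal c f : gauss_class f -> gauss_class (fun x => c * f x).

Lemma pow_exp_bounded m : exists M, forall t, 0 <= t -> t ^ m * exp (- t) <= M.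
Proof.
  destruct (exp_neg_le_Rpower (INR m) (pos_INR m)) as (C & C0 & H).
  exists (1 + C). intros t [Ht|<-].
  - specialize (H t Ht). rewrite Rpower_Ropp, Rpower_pow in H by trivial.
    assert (P : 0 < t ^ m) by now apply pow_lt.
    apply Rle_trans with (t ^ m * (C * / t ^ m)).
    + apply Rmult_le_compat_l; lra.
    + replace (t ^ m * (C * / t ^ m)) with C by (field; lra). lra.
  - rewrite Ropp_0, exp_0. destruct m as [|m]; [simpl; lra|].
    rewrite pow_i by lia. lra.
Qed.

Lemma gauss_rapid f : gauss_class f -> rapid f.
Proof.
  revert f. apply rapid_of_class.
  - intros f H. induction H as [k|f g Hf (f' & Ff & Df) Hg (g' & Fg & Dg)|c f Hf (f' & Ff & Df)].
    + exists (fun x => INR k * (x ^ pred k * exp (- x ^ 2))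
        + - 2 * (x ^ S k * exp (- x ^ 2))).
      split; [apply gauss_plus; apply gauss_scal; apply gauss_mono|].
      intros y. auto_derive; trivial. simpl. ring.
    + exists (fun x => f' x + g' x). split; [now apply gauss_plus|].
      intros y. now apply (is_derive_plus (V := R_NormedModule)).
    + exists (fun x => c * f' x). split; [now apply gauss_scal|].
      intros y. now apply is_derive_scal.
  - intros f j H. induction H as [k|f g Hf [C HC] Hg [D HD]|c f Hf [C HC]].
    + destruct (pow_exp_bounded (j + k)) as [M HM]. exists (1 + M). intros y.
      rewrite Rabs_mult, <- RPow_abs, <- Rmult_assoc, <- pow_add.
      rewrite (Rabs_pos_eq (exp _)) by apply Rlt_le, exp_pos.
      specialize (HM (y ^ 2) (pow2_ge_0 y)).
      assert (E1 : exp (- y ^ 2) <= 1).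
      { rewrite <- exp_0. destruct (Req_dec (- y ^ 2) 0) as [->|n]; [lra|].
        apply Rlt_le, exp_increasing. generalize (pow2_ge_0 y). lra. }
      assert (E0 := exp_pos (- y ^ 2)).
      assert (Rabs y ^ (j + k) <= 1 + (y ^ 2) ^ (j + k)).
      { rewrite <- pow2_abs. assert (A := Rabs_pos y).
        destruct (Rle_dec (Rabs y) 1) as [h|h].
        - apply Rle_trans with (1 ^ (j + k)); [apply pow_incr; lra|].
          rewrite pow1. assert (0 <= (Rabs y ^ 2) ^ (j + k)) by apply pow_le, pow_le, A. lra.
        - apply Rle_trans with ((Rabs y ^ 2) ^ (j + k)); [|lra].
          apply pow_incr. split; [lra|]. nra. }
      nra.
    + exists (C + D). intros y. specialize (HC y). specialize (HD y).
      apply Rle_trans with (Rabs y ^ j * (Rabs (f y) + Rabs (g y))); [|lra].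
      apply Rmult_le_compat_l; [apply pow_le, Rabs_pos | apply Rabs_triang].
    + exists (Rabs c * C). intros y. rewrite Rabs_mult.
      replace (Rabs y ^ j * (Rabs c * Rabs (f y)))
        with (Rabs c * (Rabs y ^ j * Rabs (f y))) by ring.
      apply Rmult_le_compat_l; auto using Rabs_pos.
Qed.

Lemma Derive_n_zero n x : Derive_n (fun _ => 0) n x = 0.
Proof. destruct n; [easy|]. apply Derive_n_const. Qed.

Lemma schwartz_gauss : schwartz (fun x => RtoC (exp (- x ^ 2))).
Proof.
  assert (G : rapid (fun x => exp (- x ^ 2))).
  { intros n. assert (K := gauss_rapid _ (gauss_mono 0)).
    destruct (K n) as [E B].
    assert (Q : forall t, t ^ 0 * exp (- t ^ 2) = exp (- t ^ 2)) by (intros; simpl; ring).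
    split.
    - intros y. apply ex_derive_n_ext with (2 := E y). exact Q.
    - intros j. destruct (B j) as [M HM]. exists M. intros y.
      rewrite <- (Derive_n_ext _ _ n y Q). apply HM. }
  split.
  - intros n x. split; [apply G | apply (ex_derive_n_const 0)].
  - intros j n. destruct (proj2 (G n) j) as [M HM]. exists M. intros x.
    apply Rle_trans with (2 := HM x). apply Req_le. f_equal.
    unfold CDerive_n. change (fun t : R => Im (exp (- t ^ 2))) with (fun _ : R => 0).
    rewrite Derive_n_zero. apply Cmod_R.
Qed.

(** [iota] asks for uniqueness, and without any admissible regularizer [is_Os_int] would hold of
    every number. Tested on the Gaussian, two candidates are limits of the same function. *)
Lemma Itilde_value s p k : s = 1 \/ s = - 1 -> 0 < p -> Itilde s p k = os_value s p k.
Proof.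
  intros Hs Hp. unfold Itilde, Os_int.
  assert (K := is_Os_int_os_value s p k Hs Hp).
  apply (iota_unique (V := C_R_CompleteNormedModule)); trivial.
  intros z Hz.
  assert (G0 : RtoC (exp (- 0 ^ 2)) = 1%C).
  { simpl. now rewrite Rmult_0_l, Ropp_0, exp_0. }
  apply (filterlim_locally_unique (V := C_R_NormedModule) (F := at_right 0)
    _ _ _ (Hz _ schwartz_gauss G0) (K _ schwartz_gauss G0)).
Qed.

(** * Expansion of complex half-line integrals *)

Lemma sum_n_pair (f g : nat -> R) n :
  sum_n (fun k => (f k, g k) : C) n = (sum_n f n, sum_n g n).
Proof.
  induction n as [|n IH]; [now rewrite !sum_O|]. rewrite !sum_Sn, IH. reflexivity.
Qed.

Lemma Cmod_le_abs (z : C) : Cmod z <= 2 * (Rabs (Re z) + Rabs (Im z)).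
Proof.
  assert (E : z = (RtoC (Re z) + Ci * RtoC (Im z))%C).
  { destruct z as [a b]. unfold Ci, RtoC, Cmult, Cplus; cbn. f_equal; ring. }
  rewrite E at 1. apply Rle_trans with (1 := Cmod_triangle _ _).
  rewrite Cmod_mult, !Cmod_R.
  assert (Cmod Ci = 1).
  { unfold Cmod, Ci; cbn. rewrite !Rmult_0_l, !Rmult_1_l, Rplus_0_l. apply sqrt_1. }
  generalize (Rabs_pos (Re z)) (Rabs_pos (Im z)). nra.
Qed.

Definition half_line_term (s p : R) (B : R -> C) (lam : R) (k : nat) : C :=
  (Itilde s p k / RtoC (INR (fact k)) * CDerive_n B k 0
   * RtoC (Rpower lam (- ((INR k + 1) / p))))%C.

Lemma half_line_term_value s p B lam k : s = 1 \/ s = - 1 -> 0 < p ->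
  half_line_term s p B lam k =
  (let P := Rpower lam (- ((INR k + 1) / p)) in
   let a := jet (fun t => Re (B t)) k in let b := jet (fun t => Im (B t)) k in
   (a * osc_const p 0 k * P + - s * (b * osc_const p (0 - PI / 2) k * P),
    b * osc_const p 0 k * P + s * (a * osc_const p (0 - PI / 2) k * P))).
Proof.
  intros Hs Hp. unfold half_line_term. rewrite Itilde_value by trivial.
  unfold Cdiv. rewrite <- RtoC_inv by apply INR_fact_neq_0.
  unfold os_value, CDerive_n, RtoC, Cmult, jet; cbn.
  assert (F := INR_fact_neq_0 k). f_equal; field; trivial.
Qed.

Lemma half_line_expansion s p B N : s = 1 \/ s = - 1 -> 0 < p -> crapid B -> (1 <= N)%nat ->
  bO (- ((INR N + 1) / p))
    (fun lam => Cmod (half_line s p 0 B lam - sum_n (half_line_term s p B lam) (pred N))).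
Proof.
  intros Hs Hp [H1 H2] HN. destruct N as [|N]; [lia|]. cbn [pred].
  assert (X : forall phi b, rapid b -> bO (- ((INR (S N) + 1) / p)) (fun lam => Rabs (
    osc_rapid p phi 0 b lam - sum_n (fun j => jet b j * osc_const p phi j
                       * Rpower lam (- ((INR j + 1) / p))) N))).
  { intros phi b Hb. destruct (rapid_expansion p phi 0 b (S N) Hp Hb) as [C HC].
    exists C. intros lam Hlam. rewrite Rabs_Rabsolu.
    specialize (HC lam Hlam). rewrite psum_sum_n in HC. exact HC. }
  set (D phi b lam := Rabs (osc_rapid p phi 0 b lam - sum_n (fun j => jet b j * osc_const p phi j
                       * Rpower lam (- ((INR j + 1) / p))) N)) in X.
  (* Each component combines one real expansion at phase 0 with one at phase -PI/2, four in all; the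
     factor 2 is that of [Cmod_le_abs]. *)
  assert (Y := bO_scal _ 2 _ (bO_plus _ _ _
    (bO_plus _ _ _ (X 0 _ H1) (X (0 - PI / 2) _ H2))
    (bO_plus _ _ _ (X 0 _ H2) (X (0 - PI / 2) _ H1)))).
  destruct Y as [C HC]. exists C. intros lam Hlam.
  apply Rle_trans with (2 := HC lam Hlam).
  rewrite Rabs_pos_eq by apply Cmod_ge_0.
  apply Rle_trans with (2 := Rle_abs _). apply Rle_trans with (1 := Cmod_le_abs _).
  apply Rmult_le_compat_l; [lra|].
  rewrite (sum_n_ext _ _ _ (fun k => half_line_term_value s p B lam k Hs Hp)).
  cbv zeta. rewrite sum_n_pair.
  assert (SP : forall (c : R) f g n, sum_n (fun k => f k + c * g k) n = sum_n f n + c * sum_n g n).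
  { intros c f g n. induction n as [|n IH]; [now rewrite !sum_O|].
    rewrite !sum_Sn, IH. unfold plus; cbn. ring. }
  rewrite (SP (- s)), (SP s).
  assert (Hs1 : Rabs s = 1).
  { destruct Hs as [->| ->]; [apply Rabs_R1|]. rewrite Rabs_left; lra. }
  assert (T : forall c a b a' b', Rabs c = 1 ->
    Rabs (a + c * b - (a' + c * b')) <= Rabs (a - a') + Rabs (b - b')).
  { intros c a b a' b' Hc. replace (a + c * b - (a' + c * b')) with (a - a' + c * (b - b')) by ring.
    apply Rle_trans with (1 := Rabs_triang _ _). rewrite Rabs_mult, Hc. lra. }
  apply Rplus_le_compat.
  - refine (Rle_trans _ _ _ _ (T (- s) _ _ _ _ _)); [|now rewrite Rabs_Ropp].
    apply Req_le. f_equal. cbn [half_line Re Im fst snd Cminus Cplus Copp]. ring.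
  - refine (Rle_trans _ _ _ _ (T s _ _ _ _ _)); [|trivial].
    apply Req_le. f_equal.
Qed.

(** * Functions of class C^n and inverse functions *)

(** With the derivative as a witness, the sum, product and composition rules are direct inductions;
    the passage to [ex_derive_n] is made afterwards, on open sets. *)
Fixpoint Cn (n : nat) (U : R -> Prop) (f : R -> R) : Prop :=
  match n with
  | O => forall x, U x -> continuous f x
  | S n => exists f', (forall x, U x -> is_derive f x (f' x)) /\ Cn n U f'
  end.

Lemma Cn_continuous n U f : Cn n U f -> forall x, U x -> continuous f x.
Proof.
  destruct n; cbn; [tauto|]. intros (f' & H & _) x Hx.
  apply (ex_derive_continuous (V := R_NormedModule)). eexists; now apply H.
Qed.

Lemma Cn_pred n U f : Cn (S n) U f -> Cn n U f.
Proof.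
  revert f. induction n as [|n IH]; intros f H.
  - exact (Cn_continuous _ _ _ H).
  - destruct H as (f' & H & K). exists f'. split; trivial. now apply IH.
Qed.

Lemma Cn_ext n (U : R -> Prop) f g : open U ->
  (forall x, U x -> f x = g x) -> Cn n U f -> Cn n U g.
Proof.
  intros HU E. assert (L : forall x, U x -> locally x (fun y => f y = g y)).
  { intros x Hx. generalize (HU x Hx). apply filter_imp. exact E. }
  destruct n as [|n]; cbn.
  - intros H x Hx. apply continuous_ext_loc with f; auto.
  - intros (f' & H & K). exists f'. split; trivial.
    intros x Hx. apply is_derive_ext_loc with f; auto.
Qed.

Lemma Cn_subset n (U W : R -> Prop) f : (forall x, U x -> W x) -> Cn n W f -> Cn n U f.
Proof.
  intros HS. revert f. induction n as [|n IH]; intros f; cbn.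
  - intros H x Hx. auto.
  - intros (f' & H & K). exists f'. split; auto.
Qed.

Lemma Cn_const n U c : Cn n U (fun _ => c).
Proof.
  revert c. induction n as [|n IH]; intros c; cbn.
  - intros. apply continuous_const.
  - exists (fun _ => 0). split; trivial. intros. apply (is_derive_const (V := R_NormedModule)).
Qed.

Lemma Cn_id n U : Cn n U (fun x => x).
Proof.
  destruct n as [|n]; cbn.
  - intros. apply continuous_id.
  - exists (fun _ => 1). split; [|apply Cn_const]. intros. apply (is_derive_id (K := R_AbsRing)).
Qed.

Lemma Cn_plus n U f g : Cn n U f -> Cn n U g -> Cn n U (fun x => f x + g x).
Proof.
  revert f g. induction n as [|n IH]; intros f g; cbn.
  - intros H K x Hx. apply (continuous_plus (V := R_NormedModule)); auto.
  - intros (f' & H & H') (g' & K & K'). exists (fun x => f' x + g' x). split; auto.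
    intros x Hx. apply (is_derive_plus (V := R_NormedModule)); auto.
Qed.

Lemma Cn_mult n U f g : Cn n U f -> Cn n U g -> Cn n U (fun x => f x * g x).
Proof.
  revert f g. induction n as [|n IH]; intros f g F G.
  - intros x Hx. apply (continuous_mult (K := R_AbsRing)); auto.
  - assert (F0 := Cn_pred _ _ _ F). assert (G0 := Cn_pred _ _ _ G).
    destruct F as (f' & H & H'), G as (g' & K & K').
    exists (fun x => f' x * g x + f x * g' x). split.
    + intros x Hx. apply (is_derive_mult f g x); auto. intros; apply Rmult_comm.
    + apply Cn_plus; auto.
Qed.

Lemma Cn_comp n (U W : R -> Prop) f g :
  (forall x, U x -> W (g x)) -> Cn n W f -> Cn n U g -> Cn n U (fun x => f (g x)).
Proof.
  intros HW. revert f. induction n as [|n IH]; intros f F G.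
  - intros x Hx. apply continuous_comp; [apply G | apply F]; auto.
  - assert (G0 := Cn_pred _ _ _ G).
    destruct F as (f' & H & H'), G as (g' & K & K').
    exists (fun x => g' x * f' (g x)). split.
    + intros x Hx. apply (is_derive_comp f g); auto.
    + apply Cn_mult; auto.
Qed.

Lemma Cn_Rpower n c : Cn n (fun x => 0 < x) (fun x => Rpower x c).
Proof.
  revert c. induction n as [|n IH]; intros c.
  - intros x Hx. apply (ex_derive_continuous (K := R_AbsRing) (V := R_NormedModule)
      (fun y => Rpower y c)). eexists; now apply is_derive_Rpower.
  - exists (fun x => c * Rpower x (c - 1)). split.
    + intros; now apply is_derive_Rpower.
    + apply Cn_mult; [apply Cn_const | apply IH].
Qed.

Lemma Cn_PSeries n a : Cn n (fun x => Rbar_lt (Rabs x) (CV_radius a)) (PSeries a).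
Proof.
  revert a. induction n as [|n IH]; intros a.
  - intros x Hx. apply continuity_pt_filterlim. now apply PSeries_continuity.
  - exists (PSeries (PS_derive a)). split.
    + intros x Hx. now apply is_derive_PSeries.
    + apply Cn_subset with (2 := IH (PS_derive a)). intros x. now rewrite CV_radius_derive.
Qed.

Lemma Cn_Derive n (U : R -> Prop) f : open U -> Cn (S n) U f -> Cn n U (Derive f).
Proof.
  intros HU (f' & H & K). apply Cn_ext with (3 := K); trivial.
  intros x Hx. symmetry. now apply is_derive_unique, H.
Qed.

Lemma Cn_is_derive n (U : R -> Prop) f x : Cn (S n) U f -> U x -> is_derive f x (Derive f x).
Proof. intros (f' & H & _) Hx. apply Derive_correct. eexists; now apply H. Qed.

Lemma Cn_ex_derive_n n (U : R -> Prop) f : open U -> Cn n U f ->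
  forall x, U x -> ex_derive_n f n x.
Proof.
  intros HU. revert f. induction n as [|n IH]; intros f F x Hx; [easy|].
  assert (D := IH _ (Cn_Derive n U f HU F) x Hx).
  destruct n as [|n].
  - cbn. eexists. now apply (Cn_is_derive 0 U).
  - change (ex_derive (Derive_n f (S n)) x).
    apply ex_derive_ext with (2 := D). intros t. apply Derive_n_Derive.
Qed.

Lemma ex_derive_n_Cn n (U : R -> Prop) f :
  (forall k x, U x -> ex_derive_n f k x) -> Cn n U f.
Proof.
  revert f. induction n as [|n IH]; intros f H.
  - intros x Hx. apply (ex_derive_continuous (V := R_NormedModule)), (H 1%nat x Hx).
  - exists (Derive f). split.
    + intros x Hx. apply Derive_correct, (H 1%nat x Hx).
    + apply IH. intros k x Hx. now apply ex_derive_n_Derive, H.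
Qed.

(* The value [r] off the image lies outside the open interval (-r, r), so a
   function supported in that interval vanishes there after composition. *)
Definition local_inverse (f : R -> R) (r y : R) : R :=
  match excluded_middle_informative (exists x, - r < x < r /\ f x = y) with
  | left H => proj1_sig (constructive_indefinite_description _ H)
  | right _ => r
  end.

Lemma local_inverse_spec f r y : (exists x, - r < x < r /\ f x = y) ->
  - r < local_inverse f r y < r /\ f (local_inverse f r y) = y.
Proof.
  intros H. unfold local_inverse. destruct excluded_middle_informative; [|tauto].
  apply (proj2_sig (constructive_indefinite_description _ e)).
Qed.

Lemma local_inverse_outside f r y : ~ (exists x, - r < x < r /\ f x = y) ->
  local_inverse f r y = r.
Proof.
  intros H. unfold local_inverse. now destruct excluded_middle_informative.
Qed.

Definition ball0 (r x : R) : Prop := - r < x < r.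

Lemma open_Ioo a b : open (fun x : R => a < x < b).
Proof. apply open_and; [apply open_gt | apply open_lt]. Qed.

Lemma open_ball0 r : open (ball0 r).
Proof. apply open_Ioo. Qed.

(** * Smooth inverse of an increasing function *)

Section Inverse.

Context (f : R -> R) (r r1 : R) (Hr : 0 < r < r1)
  (Hf : forall n, Cn n (ball0 r1) f)
  (Hpos : forall x, ball0 r1 x -> 0 < Derive f x).

Lemma inv_increasing x y : ball0 r1 x -> ball0 r1 y -> x < y -> f x < f y.
Proof.
  intros Hx Hy Hxy.
  destruct (MVT_gen f x y (Derive f)) as (c & Hc & E).
  - intros z Hz. rewrite Rmin_left, Rmax_right in Hz by lra.
    apply (Cn_is_derive 0 (ball0 r1)); [apply Hf|]. unfold ball0 in *. lra.
  - intros z Hz. rewrite Rmin_left, Rmax_right in Hz by lra.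
    apply continuity_pt_filterlim, (Hf 0). unfold ball0 in *. lra.
  - rewrite Rmin_left, Rmax_right in Hc by lra.
    assert (0 < Derive f c) by (apply Hpos; unfold ball0 in *; lra). nra.
Qed.

Lemma inv_increasing_iff x y : ball0 r1 x -> ball0 r1 y -> (f x < f y <-> x < y).
Proof.
  intros Hx Hy. split; [|now apply inv_increasing].
  intros H. destruct (Rtotal_order x y) as [h|[->|h]]; trivial; [lra|].
  generalize (inv_increasing y x Hy Hx h). lra.
Qed.

Lemma inv_reflect x y : ball0 r1 x -> ball0 r1 y -> f x < f y -> x < y.
Proof. intros Hx Hy. now apply inv_increasing_iff. Qed.

(** Since r < r1, f is continuous on the closed interval [-r, r], so the intermediate value theorem
    applies up to the endpoints, and strict monotonicity identifies the image. *)
Lemma inv_onto y : f (- r) < y < f r <-> exists x, - r < x < r /\ f x = y.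
Proof.
  assert (B : ball0 r1 r /\ ball0 r1 (- r)) by (unfold ball0; lra).
  split.
  - intros H. destruct (IVT_interv (fun x => f x - y) (- r) r) as (z & Hz & E); try lra.
    { intros a Ha. apply continuity_pt_filterlim.
      apply (continuous_minus (V := R_NormedModule)); [|apply continuous_const].
      apply (Hf 0). unfold ball0; lra. }
    exists z. split; [|lra].
    assert (z <> r) by (intros ->; lra). assert (z <> - r) by (intros ->; lra). lra.
  - intros (x & Hx & <-). split; apply inv_increasing; try apply B; unfold ball0; lra.
Qed.

Let g := local_inverse f r.
Let V (y : R) := f (- r) < y < f r.

Lemma inv_right y : V y -> - r < g y < r /\ f (g y) = y.
Proof. intros H. now apply local_inverse_spec, inv_onto. Qed.

Lemma inv_left x : - r < x < r -> V (f x) /\ g (f x) = x.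
Proof.
  intros Hx. assert (HV : V (f x)) by (apply inv_onto; eauto).
  split; trivial. destruct (inv_right _ HV) as [H E].
  destruct (Rtotal_order (g (f x)) x) as [h|[h|h]]; trivial;
    apply inv_increasing in h; unfold ball0; lra.
Qed.

Lemma inv_between y a b : V y -> ball0 r1 a -> ball0 r1 b ->
  f a < y < f b <-> a < g y < b.
Proof.
  intros Hy Ha Hb. destruct (inv_right y Hy) as [H E].
  assert (ball0 r1 (g y)) by (unfold ball0; lra).
  rewrite <- E at 1 2. rewrite !inv_increasing_iff; trivial. tauto.
Qed.

Lemma inv_continuous y : V y -> continuous g y.
Proof.
  intros Hy. apply filterlim_locally. intros eps.
  destruct (inv_right y Hy) as [H E].
  (* The interval of radius eps around g y is clipped to [-r, r], so that f is monotone at its ends;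
     the image of the clipped interval is then a neighbourhood of y. *)
  set (a := Rmax (- r) (g y - eps)). set (b := Rmin r (g y + eps)).
  assert (He := cond_pos eps).
  assert (Ha : - r <= a < g y) by (split; [apply Rmax_l | apply Rmax_lub_lt; lra]).
  assert (Hb : g y < b <= r) by (split; [apply Rmin_glb_lt; lra | apply Rmin_l]).
  assert (Ba : ball0 r1 a) by (unfold ball0; lra).
  assert (Bb : ball0 r1 b) by (unfold ball0; lra).
  assert (Hab : f a < y < f b) by (apply inv_between; trivial; lra).
  generalize (filter_and _ _ (open_Ioo (f a) (f b) y Hab)
    (open_Ioo (f (- r)) (f r) y Hy)). apply filter_imp.
  intros z [Hz Vz]. apply (inv_between z a b Vz Ba Bb) in Hz.
  change (Rabs (g z - g y) < eps).
  assert (g y - eps <= a) by apply Rmax_r. assert (b <= g y + eps) by apply Rmin_r.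
  apply Rabs_def1; lra.
Qed.

Lemma inv_is_derive y : V y -> is_derive g y (/ Derive f (g y)).
Proof.
  intros Hy. destruct (inv_right y Hy) as [H E].
  (* A point strictly between |g y| and r: the theorem on derivatives of inverses is applied on the
     closed interval [-s, s] inside (-r, r). *)
  set (s := (Rmax (Rabs (g y)) 0 + r) / 2).
  assert (Hs : Rabs (g y) < s < r).
  { unfold s. rewrite Rmax_left by apply Rabs_pos.
    assert (Rabs (g y) < r) by (apply Rabs_def1; lra). lra. }
  assert (Hsg := Rabs_def2 _ _ (proj1 Hs)).
  assert (I1 := inv_left s ltac:(lra)). assert (I2 := inv_left (- s) ltac:(lra)).
  assert (Prf : forall a, g (f (- s)) <= a <= g (f s) -> derivable_pt f a).
  { intros a Ha. rewrite (proj2 I1), (proj2 I2) in Ha. apply ex_derive_Reals_0.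
    eexists. apply (Cn_is_derive 0 (ball0 r1)); [apply Hf|]. unfold ball0; lra. }
  assert (Hsy : f (- s) < y < f s).
  { apply inv_between; unfold ball0; trivial; lra. }
  assert (Prg : g (f (- s)) <= g y <= g (f s)).
  { rewrite (proj2 I1), (proj2 I2). lra. }
  assert (D : derive_pt f (g y) (Prf (g y) Prg) = Derive f (g y)).
  { apply Derive_Reals. }
  replace (/ Derive f (g y)) with (1 / derive_pt f (g y) (Prf (g y) Prg))
    by (rewrite D; unfold Rdiv; ring).
  apply is_derive_Reals. apply derivable_pt_lim_recip_interv with (ub := f s) (lb := f (- s)).
  - apply continuity_pt_filterlim. now apply inv_continuous.
  - lra.
  - trivial.
  - intros x Hx. unfold comp, id. apply inv_right. unfold V in *. lra.
  - rewrite D. apply Rgt_not_eq, Hpos. unfold ball0; lra.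
Qed.

Lemma inv_Cn n : Cn n V g.
Proof.
  induction n as [|n IH].
  - exact inv_continuous.
  (* Bootstrap from g' = 1 / f'(g): if g is C^n then so is g'. The reciprocal is written as a power
     because powers are already known to be smooth on (0, oo). *)
  - exists (fun y => Rpower (Derive f (g y)) (- 1)). split.
    + intros y Hy. replace (- 1) with (Ropp 1) by ring. rewrite Rpower_Ropp, Rpower_1.
      * now apply inv_is_derive.
      * apply Hpos. destruct (inv_right y Hy). unfold ball0; lra.
    + apply (Cn_comp n V (ball0 r1) (fun x => Rpower (Derive f x) (- 1))); trivial.
      * intros y Hy. destruct (inv_right y Hy). unfold ball0; lra.
      * apply (Cn_comp n (ball0 r1) (fun x => 0 < x) (fun x => Rpower x (- 1))).
        -- apply Hpos.
        -- apply Cn_Rpower.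
        -- apply Cn_Derive; [apply open_ball0 | apply Hf].
Qed.

End Inverse.

(** * The phase function *)

Lemma rpow_nonneg x p : 0 <= rpow x p.
Proof.
  destruct (Rlt_dec 0 x).
  - rewrite rpow_pos by trivial. apply Rlt_le, Rpower_pos.
  - rewrite rpow_nonpos; lra.
Qed.

Lemma root_bound_nonneg a l0 : is_lub (root_set a) l0 -> 0 <= l0.
Proof.
  intros [H _]. apply Rle_trans with (rpow (Rabs (a 1%nat)) (/ INR 1)); [apply rpow_nonneg|].
  apply H. now exists 1%nat.
Qed.

Lemma root_bound_coef a l0 j : is_lub (root_set a) l0 -> Rabs (a (S j)) <= l0 ^ S j.
Proof.
  intros H. assert (L := root_bound_nonneg a l0 H).
  destruct (Req_dec (a (S j)) 0) as [->|n].
  - rewrite Rabs_R0. now apply pow_le.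
  - assert (A := Rabs_pos_lt _ n).
    assert (K : rpow (Rabs (a (S j))) (/ INR (S j)) <= l0).
    { apply (proj1 H). exists (S j). split; [lia|trivial]. }
    rewrite rpow_pos in K by trivial.
    assert (Q : INR (S j) <> 0) by now apply not_0_INR.
    replace (Rabs (a (S j))) with (Rpower (Rabs (a (S j))) (/ INR (S j)) ^ S j).
    + apply pow_incr. split; trivial. apply Rlt_le, Rpower_pos.
    + rewrite <- Rpower_pow by apply Rpower_pos.
      rewrite Rpower_mult, Rinv_l, Rpower_1; trivial.
Qed.

(** A division-free form of the radius condition that treats l0 = 0 and l0 > 0 alike. *)
Lemma in_radius_iff l0 x : 0 <= l0 -> in_radius l0 x <-> l0 * Rabs x < / 2.
Proof.
  intros H. unfold in_radius, radius. destruct Req_EM_T as [->|n]; cbn.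
  - rewrite Rmult_0_l. split; [lra|trivial].
  - assert (0 < l0) by lra.
    replace (/ (2 * l0)) with (/ 2 * / l0) by (field; lra).
    split; intros K.
    + apply Rmult_lt_compat_l with (r := l0) in K; trivial.
      replace (l0 * (/ 2 * / l0)) with (/ 2) in K by (field; lra). trivial.
    + apply Rmult_lt_reg_l with l0; trivial.
      replace (l0 * (/ 2 * / l0)) with (/ 2) by (field; lra). trivial.
Qed.

(** With q = l0 |x| < 1/2 the series is dominated by the geometric one, of sum q / (1 - q) < 1. This
    is the origin of the factor 2 in the radius: it keeps the base of the 1/p-th power positive. *)
Lemma series_in_radius a l0 x : is_lub (root_set a) l0 -> in_radius l0 x ->
  ex_series (fun j => a (S j) * x ^ S j) /\ 0 < one_plus_series a x.
Proof.
  intros H Hx. assert (L := root_bound_nonneg a l0 H).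
  apply in_radius_iff in Hx; trivial.
  set (q := l0 * Rabs x) in *.
  assert (Hq : 0 <= q) by (apply Rmult_le_pos; auto using Rabs_pos).
  assert (G : is_series (fun j => q * q ^ j) (q * / (1 - q))).
  { apply (is_series_scal (V := R_NormedModule) q), is_series_geom. rewrite Rabs_pos_eq; lra. }
  assert (B : forall j, Rabs (a (S j) * x ^ S j) <= q * q ^ j).
  { intros j. rewrite Rabs_mult, <- RPow_abs. change (q * q ^ j) with (q ^ S j). unfold q.
    rewrite Rpow_mult_distr. apply Rmult_le_compat_r; [apply pow_le, Rabs_pos|].
    now apply root_bound_coef. }
  assert (EA : ex_series (fun j => Rabs (a (S j) * x ^ S j))).
  { apply (ex_series_le (V := R_CompleteNormedModule)) with (fun j => q * q ^ j).
    - intros j. change (Rabs (Rabs (a (S j) * x ^ S j)) <= q * q ^ j).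
      now rewrite Rabs_Rabsolu.
    - now exists (q * / (1 - q)). }
  split; [now apply ex_series_Rabs|].
  unfold one_plus_series.
  assert (K : Rabs (Series (fun j => a (S j) * x ^ S j)) <= q * / (1 - q)).
  { apply Rle_trans with (1 := Series_Rabs _ EA).
    rewrite <- (is_series_unique _ _ G). apply Series_le; [|now exists (q * / (1 - q))].
    intros j. split; [apply Rabs_pos|apply B]. }
  assert (q * / (1 - q) < 1).
  { apply Rmult_lt_reg_r with (1 - q); [lra|]. rewrite Rmult_assoc, Rinv_l by lra. lra. }
  apply Rabs_le_between in K. lra.
Qed.

Lemma one_plus_series_PSeries a x :
  one_plus_series a x = 1 + x * PSeries (fun j => a (S j)) x.
Proof.
  unfold one_plus_series, PSeries. f_equal. rewrite <- Series_scal_l.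
  apply Series_ext. intros j. simpl. ring.
Qed.

Lemma phase_root_local p a l0 : 0 < p -> is_lub (root_set a) l0 ->
  exists r, 0 < r /\ (forall n, Cn n (ball0 r) (phase_root p a)) /\
    forall x, ball0 r x -> in_radius l0 x /\ in_radius l0 (phase_root p a x) /\
      0 < Derive (phase_root p a) x.
Proof.
  intros Hp H. assert (L := root_bound_nonneg a l0 H).
  (* Below the radius of the statement, and well defined also for l0 = 0. *)
  set (rho := / (2 * (l0 + 1))).
  assert (Hrho : 0 < rho) by (apply Rinv_0_lt_compat; lra).
  assert (RI : forall x, ball0 rho x -> in_radius l0 x).
  { intros x Hx. apply in_radius_iff; trivial.
    assert (Rabs x < rho) by (apply Rabs_def1; unfold ball0 in Hx; lra).
    assert (rho * (l0 + 1) = / 2) by (unfold rho; field; lra).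
    generalize (Rabs_pos x). nra. }
  set (d := fun j => a (S j)).
  assert (CD : forall x, ball0 rho x -> Rbar_lt (Rabs x) (CV_radius d)).
  { intros x Hx. assert (Hx' : Rabs x < rho) by (apply Rabs_def1; unfold ball0 in Hx; lra).
    (* Boundedness of |d n| t^n gives only t <= [CV_radius d]; choosing t > |x| makes the inequality
       strict. The bound is l0 (l0 t)^n <= l0. *)
    set (t := (Rabs x + rho) / 2).
    assert (Ht : Rabs x < t < rho) by (unfold t; lra).
    apply Rbar_lt_le_trans with t; [apply Ht|].
    apply (CV_radius_bounded d). exists l0. intros n.
    assert (0 < t) by (generalize (Rabs_pos x); lra).
    rewrite Rabs_mult, (Rabs_pos_eq (t ^ n)) by (apply pow_le; lra).
    apply Rle_trans with (l0 ^ S n * t ^ n).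
    { apply Rmult_le_compat_r; [apply pow_le; lra|]. now apply root_bound_coef. }
    simpl. rewrite Rmult_assoc, <- Rpow_mult_distr.
    assert (K : (l0 * t) ^ n <= 1 ^ n).
    { apply pow_incr. split; [nra|].
      assert (rho * (l0 + 1) = / 2) by (unfold rho; field; lra). nra. }
    rewrite pow1 in K. nra. }
  set (f := phase_root p a).
  set (h := fun x => Rpower (1 + x * PSeries d x) (/ p)).
  assert (Ef : forall x, ball0 rho x -> x * h x = f x).
  { intros x Hx. unfold f, phase_root, h, d. rewrite <- one_plus_series_PSeries.
    rewrite rpow_pos; trivial. apply (series_in_radius a l0 x H), RI, Hx. }
  assert (Ch : forall n, Cn n (ball0 rho) h).
  { intros n. apply (Cn_comp n (ball0 rho) (fun x => 0 < x)
      (fun x => Rpower x (/ p)) (fun x => 1 + x * PSeries d x)).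
    - intros x Hx. unfold d. rewrite <- one_plus_series_PSeries.
      apply (series_in_radius a l0 x H), RI, Hx.
    - apply Cn_Rpower.
    - apply Cn_plus; [apply Cn_const|]. apply Cn_mult; [apply Cn_id|].
      apply Cn_subset with (2 := Cn_PSeries n d). exact CD. }
  assert (Cf : forall n, Cn n (ball0 rho) f).
  { intros n. apply Cn_ext with (2 := Ef); [apply open_ball0|].
    apply Cn_mult; [apply Cn_id | apply Ch]. }
  assert (B0 : ball0 rho 0) by (unfold ball0; lra).
  assert (D0 : Derive f 0 = 1).
  { apply is_derive_unique. apply is_derive_ext_loc with (fun x => x * h x).
    - generalize (open_ball0 rho 0 B0). apply filter_imp. exact Ef.
    - evar_last.
      + apply (is_derive_mult (fun x => x) h 0).
        * apply (is_derive_id (K := R_AbsRing)).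
        * apply (Cn_is_derive 0 (ball0 rho)); trivial.
        * intros; apply Rmult_comm.
      + change (1 * h 0 + 0 * Derive h 0 = 1). unfold h.
        rewrite !Rmult_0_l, !Rplus_0_r. unfold Rpower. rewrite ln_1, Rmult_0_r, exp_0. ring. }
  assert (f0 : f 0 = 0) by (unfold f, phase_root; ring).
  assert (K1 : locally 0 (fun x => 0 < Derive f x)).
  { assert (CC := Cn_continuous 0 _ _ (Cn_Derive 0 _ _ (open_ball0 rho) (Cf 1%nat)) 0 B0).
    apply (CC (fun z => 0 < z)). rewrite D0. apply open_gt. lra. }
  assert (K2 : locally 0 (fun x => ball0 rho (f x))).
  { assert (CC := Cn_continuous 0 _ _ (Cf O) 0 B0).
    apply (CC (ball0 rho)). rewrite f0. now apply open_ball0. }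
  (* From f(0) = 0 and f'(0) = 1, a smaller ball has f' > 0 and is mapped by f into the ball of
     radius rho; the latter will place the domain of the inverse inside the radius. *)
  destruct (filter_and _ _ (filter_and _ _ K1 K2) (open_ball0 rho 0 B0)) as [e He].
  assert (Q : forall x, ball0 e x -> ((0 < Derive f x) /\ ball0 rho (f x)) /\ ball0 rho x).
  { intros x Hx. apply He. change (Rabs (x - 0) < e). apply Rabs_def1; unfold ball0 in Hx; lra. }
  exists e. split; [apply cond_pos|]. split.
  - intros n. apply Cn_subset with (2 := Cf n). intros x Hx. apply (Q x Hx).
  - intros x Hx. destruct (Q x Hx) as [[X1 X2] X3]. repeat split; trivial; now apply RI.
Qed.

Lemma rapid_compact b A B : (forall n y, ex_derive_n b n y) ->
  (forall y, b y <> 0 -> A <= y <= B) -> A <= B -> rapid b.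
Proof.
  intros Hd Hs HAB.
  assert (Z : forall n y, ~ (A <= y <= B) -> Derive_n b n y = 0).
  { intros n y Hy. rewrite <- (Derive_n_zero n y). apply Derive_n_ext_loc.
    assert (Y : locally y (fun z => z < A \/ B < z)).
    { destruct (Rlt_dec y A) as [h|h].
      - generalize (open_lt A y h). apply filter_imp. tauto.
      - generalize (open_gt B y ltac:(lra)). apply filter_imp. tauto. }
    generalize Y. apply filter_imp. intros z Hz.
    destruct (Req_dec (b z) 0) as [E|E]; trivial. apply Hs in E. lra. }
  intros n. split; [apply Hd|]. intros j.
  destruct (continuity_ab_maj (fun y => Rabs y ^ j * Rabs (Derive_n b n y)) A B HAB)
    as (m & Hm & _).
  { intros c _. apply continuity_pt_filterlim.
    apply (continuous_mult (K := R_AbsRing) (fun y => Rabs y ^ j)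
      (fun y => Rabs (Derive_n b n y))).

    - apply (continuous_comp Rabs (fun t => t ^ j)).
      + apply continuous_Rabs.
      + apply pow_continuous.
    - apply (continuous_comp (Derive_n b n) Rabs).
      + apply (ex_derive_continuous (V := R_NormedModule)). exact (Hd (S n) c).
      + apply continuous_Rabs. }
  exists (Rabs (Rabs m ^ j * Rabs (Derive_n b n m))). intros y.
  destruct (Rle_dec A y) as [h1|h1]; [destruct (Rle_dec y B) as [h2|h2]|].
  - apply Rle_trans with (1 := Hm y (conj h1 h2)), Rle_abs.
  - rewrite Z by lra. rewrite Rabs_R0, Rmult_0_r. apply Rabs_pos.
  - rewrite Z by lra. rewrite Rabs_R0, Rmult_0_r. apply Rabs_pos.
Qed.

Lemma rapid_opp b : rapid b -> rapid (fun y => b (- y)).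
Proof.
  intros H n.
  assert (L : forall y n, locally (- y) (fun z => forall k, (k <= n)%nat -> ex_derive_n b k z)).
  { intros y m. apply filter_forall. intros z k _. apply H. }
  split.
  - intros y. now apply ex_derive_n_comp_opp.
  - intros j. destruct (proj2 (H n) j) as [M HM]. exists M. intros y.
    rewrite Derive_n_comp_opp by trivial. rewrite Rabs_mult, pow_1_abs, Rmult_1_l.
    rewrite <- (Rabs_Ropp y). apply HM.
Qed.

(** * Supports and change of variables *)

Lemma supp_nonzero (u : R -> C) x : u x <> 0%C -> supp u x.
Proof.
  intros H V [d HV]. exists x. split; [|exact H]. apply HV.
  unfold disc. rewrite Rminus_diag, Rabs_R0. apply cond_pos.
Qed.

Lemma not_supp_locally_zero (u : R -> C) x : ~ supp u x ->
  exists d, 0 < d /\ forall z, Rabs (z - x) < d -> u z = 0%C.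
Proof.
  intros H. apply NNPP. intros K. apply H. intros V [d HV]. apply NNPP. intros L.
  apply K. exists d. split; [apply cond_pos|]. intros z Hz.
  apply NNPP. intros N. apply L. exists z. split; [now apply HV|exact N].
Qed.

(** The points r and -r lie outside the support, which is closed, so u vanishes near both; this
    leaves a positive margin inside the open interval. *)
Lemma supp_in_smaller_ball (u : R -> C) r : 0 < r -> included (supp u) (ball0 r) ->
  exists c, 0 < c < r /\ forall x, u x <> 0%C -> - c <= x <= c.
Proof.
  intros Hr H.
  destruct (not_supp_locally_zero u r) as (d1 & P1 & D1).
  { intros K. apply H in K. unfold ball0 in K. lra. }
  destruct (not_supp_locally_zero u (- r)) as (d2 & P2 & D2).
  { intros K. apply H in K. unfold ball0 in K. lra. }
  exists (Rmax (r / 2) (Rmax (r - d1) (r - d2))).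
  assert (M1 := Rmax_l (r / 2) (Rmax (r - d1) (r - d2))).
  assert (M2 := Rmax_r (r / 2) (Rmax (r - d1) (r - d2))).
  assert (M3 := Rmax_l (r - d1) (r - d2)). assert (M4 := Rmax_r (r - d1) (r - d2)).
  split.
  - split; [lra|]. repeat apply Rmax_lub_lt; lra.
  - intros x Hx. assert (S := H x (supp_nonzero u x Hx)). unfold ball0 in S.
    set (c := Rmax _ _) in *. split; apply Rnot_lt_le; intros N; apply Hx.
    + apply D2. apply Rabs_def1; lra.
    + apply D1. apply Rabs_def1; lra.
Qed.

Lemma rapid_ext b b' : (forall y, b y = b' y) -> rapid b -> rapid b'.
Proof.
  intros E H n. destruct (H n) as [D B]. split.
  - intros y. now apply ex_derive_n_ext with b.
  - intros j. destruct (B j) as [M HM]. exists M. intros y.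
    rewrite <- (Derive_n_ext b b' n y E). apply HM.
Qed.

Lemma continuous_C (h : R -> C) x :
  continuous (fun t => Re (h t)) x -> continuous (fun t => Im (h t)) x ->
  continuous (U := C_R_NormedModule) h x.
Proof.
  intros H1 H2. apply (filterlim_locally (U := C_R_NormedModule)). intros eps.
  assert (K1 := proj1 (filterlim_locally _ _) H1 eps).
  assert (K2 := proj1 (filterlim_locally _ _) H2 eps).
  generalize (filter_and _ _ K1 K2). apply filter_imp. intros y [B1 B2]. now split.
Qed.

Lemma is_RInt_zero (V : NormedModule R_AbsRing) (f : R -> V) a b : a <= b ->
  (forall x, a < x < b -> f x = zero) -> is_RInt f a b zero.
Proof.
  intros Hab H. apply (is_RInt_ext (fun _ => zero)).
  - intros x Hx. rewrite Rmin_left, Rmax_right in Hx by trivial. now rewrite H.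
  - assert (E := is_RInt_const a b (zero : V)).
    assert (Z : scal (b - a) (zero : V) = zero).
    { exact (scal_zero_r (K := R_AbsRing) (b - a)). }
    now rewrite Z in E.
Qed.

Lemma is_RInt_gen_compact_half (V : NormedModule R_AbsRing) (f : R -> V) b l : 0 <= b ->
  (forall x, b < x -> f x = zero) -> is_RInt f 0 b l ->
  is_RInt_gen f (at_point 0) (Rbar_locally p_infty) l.
Proof.
  intros Hb Hz Hl P HP.
  apply Filter_prod with (fun x => x = 0) (fun x => b < x); [easy|now exists b|].
  intros x y -> Hy. exists l. split; [|now apply locally_singleton].
  cbn [fst snd]. rewrite <- (plus_zero_r l). apply is_RInt_Chasles with (1 := Hl).
  apply is_RInt_zero; [lra|]. intros z Hz'. apply Hz. lra.
Qed.

Lemma is_RInt_gen_compact_line (V : NormedModule R_AbsRing) (f : R -> V) a b l : a <= b ->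
  (forall x, x < a \/ b < x -> f x = zero) -> is_RInt f a b l ->
  is_RInt_gen f (Rbar_locally m_infty) (Rbar_locally p_infty) l.
Proof.
  intros Hb Hz Hl P HP.
  apply Filter_prod with (fun x => x < a) (fun x => b < x); [now exists a|now exists b|].
  intros x y Hx Hy. exists l. split; [|now apply locally_singleton].
  cbn [fst snd]. rewrite <- (plus_zero_r l). apply is_RInt_Chasles with b.
  - rewrite <- (plus_zero_l l). apply is_RInt_Chasles with (2 := Hl).
    apply is_RInt_zero; [lra|]. intros z Hz'. apply Hz. lra.
  - apply is_RInt_zero; [lra|]. intros z Hz'. apply Hz. lra.
Qed.

Lemma is_RInt_of_compact_half (f : R -> C_R_CompleteNormedModule) b l : 0 <= b ->
  (forall x, b < x -> f x = zero) ->
  is_RInt_gen f (at_point 0) (Rbar_locally p_infty) l -> is_RInt f 0 b l.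
Proof.
  intros Hb Hz Hl.
  assert (E : ex_RInt f 0 b).
  { destruct (Hl (fun _ => True) filter_true) as [Q1 Q2 H1 [X H2] H].
    set (y := Rmax (X + 1) b).
    assert (Hy : X < y /\ b <= y).
    { unfold y. generalize (Rmax_l (X + 1) b) (Rmax_r (X + 1) b). lra. }
    destruct (H 0 y H1 (H2 y (proj1 Hy))) as (I & HI & _).
    apply (ex_RInt_Chasles_1 (V := C_R_CompleteNormedModule)) with y; [lra|]. now exists I. }
  assert (K := RInt_correct _ _ _ E).
  assert (G := is_RInt_gen_compact_half _ _ _ _ Hb Hz K).
  rewrite <- (is_RInt_gen_unique (V := C_R_CompleteNormedModule) f l Hl).
  now rewrite (is_RInt_gen_unique (V := C_R_CompleteNormedModule) f _ G).
Qed.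

(** * The amplitude in the new variable *)

Section Amplitude.

Context (f : R -> R) (r r1 : R) (Hr : 0 < r < r1)
  (Hf : forall n, Cn n (ball0 r1) f)
  (Hpos : forall x, ball0 r1 x -> 0 < Derive f x).

Let g := local_inverse f r.
Let V (y : R) := f (- r) < y < f r.

(** Off the image of (-r, r) the local inverse takes the value r, which b excludes because c < r; on
    the image, monotonicity of f transports the bounds. *)
Lemma inverse_support (b : R -> Prop) c : 0 < c < r ->
  (forall x, b x -> - c <= x <= c) -> forall y, b (g y) -> f (- c) <= y <= f c.
Proof.
  intros Hc Hb y Hy.
  destruct (excluded_middle_informative (exists x, - r < x < r /\ f x = y)) as [h|h].
  - destruct (local_inverse_spec f r y h) as [H E]. fold g in H, E.
    assert (K := Hb _ Hy). rewrite <- E.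
    split; apply Rnot_lt_le; intros N;
      apply (inv_reflect f r1 Hf Hpos) in N; unfold ball0; lra.
  - unfold g in Hy. rewrite local_inverse_outside in Hy by trivial.
    apply Hb in Hy. lra.
Qed.

(** Smoothness on the whole line although g is smooth only on V: the product vanishes outside the
    compact interval [f(-c), f(c)], which lies inside V, hence near every point outside V. *)
Lemma amplitude_rapid b c : (forall n x, ex_derive_n b n x) -> 0 < c < r ->
  (forall x, b x <> 0 -> - c <= x <= c) -> rapid (fun y => b (g y) * Derive g y).
Proof.
  intros Hb Hc Hs.
  assert (Sp : forall y, b (g y) * Derive g y <> 0 -> f (- c) <= y <= f c).
  { intros y Hy. apply (inverse_support (fun x => b x <> 0) c Hc Hs).
    intros E. apply Hy. rewrite E. ring. }
  assert (I : forall x y, - r1 < x -> x < y -> y < r1 -> f x < f y).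
  { intros x y h1 h2 h3. apply (inv_increasing f r1 Hf Hpos); unfold ball0; lra. }
  assert (I1 := I (- r) (- c) ltac:(lra) ltac:(lra) ltac:(lra)).
  assert (I2 := I (- c) c ltac:(lra) ltac:(lra) ltac:(lra)).
  assert (I3 := I c r ltac:(lra) ltac:(lra) ltac:(lra)).
  apply rapid_compact with (f (- c)) (f c); trivial; [|lra].
  intros n y. destruct (excluded_middle_informative (V y)) as [h|h].
  - apply (Cn_ex_derive_n n V); trivial; [exact (open_Ioo _ _)|].
    assert (Gn := fun n => inv_Cn f r r1 Hr Hf Hpos n).
    apply (Cn_mult n V (fun y => b (g y)) (Derive g)).
    + apply (Cn_comp n V (fun _ => True) b g); trivial.
      apply ex_derive_n_Cn. intros; apply Hb.
    + exact (Cn_Derive n V g (open_Ioo _ _) (Gn (S n))).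
  - apply ex_derive_n_ext_loc with (fun _ => 0); [|apply ex_derive_n_const].
    assert (Y : locally y (fun z => z < f (- c) \/ f c < z)).
    { destruct (Rlt_dec y (f (- c))) as [k|k].
      - generalize (open_lt _ y k). apply filter_imp. tauto.
      - generalize (open_gt (f c) y ltac:(unfold V in h; lra)). apply filter_imp. tauto. }
    generalize Y. apply filter_imp. intros z Hz.
    destruct (Req_dec (b (g z) * Derive g z) 0) as [E|E]; [easy|]. apply Sp in E. lra.
Qed.

Lemma crapid_amplitude (u : R -> C) c : test_function u -> 0 < c < r ->
  (forall x, u x <> 0%C -> - c <= x <= c) ->
  crapid (fun y => (u (g y) * RtoC (Derive g y))%C).
Proof.
  intros [Hu _] Hc Hs. split.
  - apply rapid_ext with (fun y => Re (u (g y)) * Derive g y).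
    { intros y. unfold Re; cbn. ring. }
    apply (amplitude_rapid (fun x => Re (u x)) c); trivial.
    + intros n x. apply Hu.
    + intros x Hx. apply Hs. intros E. apply Hx. now rewrite E.
  - apply rapid_ext with (fun y => Im (u (g y)) * Derive g y).
    { intros y. unfold Im; cbn. ring. }
    apply (amplitude_rapid (fun x => Im (u x)) c); trivial.
    + intros n x. apply Hu.
    + intros x Hx. apply Hs. intros E. apply Hx. now rewrite E.
Qed.

(** The substitution x = g y on a compact interval. The phase [th] is left general so as to cover
    both the real power on the half-line and the integer power on the whole line. *)
Lemma amplitude_change_of_variables (th : R -> R) (u : R -> C) a b :
  (forall x, continuous th x) -> Csmooth u -> - r < a -> a <= b -> b < r ->
  exists l : C,
    is_RInt (V := C_R_NormedModule) (fun x => (expi (th (f x)) * u x)%C) a b l /\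
    is_RInt (V := C_R_NormedModule)
      (fun y => (expi (th y) * (u (g y) * RtoC (Derive g y)))%C) (f a) (f b) l.
Proof.
  intros Hth Hu Ha Hab Hb.
  set (h := fun x => (expi (th (f x)) * u x)%C : C_R_CompleteNormedModule).
  assert (Hc : forall x, - r < x < r -> continuous h x).
  { intros x Hx.
    assert (Ct : continuous (fun x => th (f x)) x).
    { apply continuous_comp; [|apply Hth]. apply (Hf 0). unfold ball0; lra. }
    assert (Cu : continuous (fun x => Re (u x)) x /\ continuous (fun x => Im (u x)) x).
    { split; apply (ex_derive_continuous (V := R_NormedModule)); apply (Hu 1%nat x). }
    apply continuous_C.
    - apply (continuous_minus (V := R_NormedModule)); apply (continuous_mult (K := R_AbsRing)).
      + now apply continuous_cos_comp.
      + apply Cu.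
      + now apply continuous_sin_comp.
      + apply Cu.
    - apply (continuous_plus (V := R_NormedModule)); apply (continuous_mult (K := R_AbsRing)).
      + now apply continuous_cos_comp.
      + apply Cu.
      + now apply continuous_sin_comp.
      + apply Cu. }
  assert (Va := proj1 (inv_left f r r1 Hr Hf Hpos a ltac:(lra))).
  assert (Vb := proj1 (inv_left f r r1 Hr Hf Hpos b ltac:(lra))).
  assert (Ga := proj2 (inv_left f r r1 Hr Hf Hpos a ltac:(lra))).
  assert (Gb := proj2 (inv_left f r r1 Hr Hf Hpos b ltac:(lra))).
  cbv beta in Va, Vb. fold g in Ga, Gb.
  assert (Hfab : f a <= f b).
  { destruct Hab as [h'| ->]; [|lra].
    apply Rlt_le, (inv_increasing f r1 Hf Hpos); unfold ball0; lra. }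
  exists (RInt h a b). split.
  - apply (RInt_correct h), (ex_RInt_continuous h).
    intros z Hz. rewrite Rmin_left, Rmax_right in Hz by trivial. apply Hc. lra.
  - assert (K := is_RInt_comp h g (Derive g) (f a) (f b)).
    rewrite Ga, Gb in K. rewrite Rmin_left, Rmax_right in K by trivial.
    assert (HV : forall y, f a <= y <= f b -> V y) by (unfold V; intros; lra).
    refine (is_RInt_ext _ _ _ _ _ _ (K _ _)).
    + intros y Hy. rewrite Rmin_left, Rmax_right in Hy by trivial.
      destruct (inv_right f r r1 Hr Hf Hpos y) as [_ E]; [apply HV; lra|].
      fold g in E. unfold h. rewrite E.
      destruct (u (g y)) as [u1 u2]. unfold expi, Cmult, RtoC, scal; cbn.
      unfold prod_scal, scal, mult; cbn. f_equal; ring.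
    + intros y Hy. apply Hc, (inv_right f r r1 Hr Hf Hpos y), HV, Hy.
    + intros y Hy. assert (Hg := inv_Cn f r r1 Hr Hf Hpos 1). split.
      * apply (Cn_is_derive 0 V); [apply Hg | now apply HV].
      * apply (Cn_continuous 0 V); [|now apply HV].
        exact (Cn_Derive 0 V g (open_Ioo _ _) Hg).
Qed.

End Amplitude.

Lemma is_RInt_half_line s p B lam b : s = 1 \/ s = - 1 -> 0 < p -> crapid B ->
  0 <= b -> (forall y, b < y -> B y = 0%C) ->
  is_RInt (V := C_R_NormedModule)
    (fun y => (expi (s * (lam * rpow y p)) * B y)%C) 0 b (half_line s p 0 B lam).
Proof.
  intros Hs Hp HB Hb Hz. apply is_RInt_of_compact_half; trivial.
  - intros x Hx. rewrite Hz by trivial. apply Cmult_0_r.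
  - refine (is_RInt_gen_ext _ _ _ _ (is_RInt_gen_half_line s p 0 B lam Hs Hp HB)).
    apply filter_forall. intros ab y _. cbn [pow]. now rewrite Cmult_1_l.
Qed.

Lemma CInt_line_unique (h : R -> C) (l : C) :
  is_RInt_gen (V := C_R_NormedModule) h (Rbar_locally m_infty) (Rbar_locally p_infty) l ->
  CInt_line h = l.
Proof. exact (is_RInt_gen_unique (V := C_R_CompleteNormedModule) h l). Qed.

Lemma crapid_opp B : crapid B -> crapid (fun y => B (- y)).
Proof.
  intros [H1 H2].
  exact (conj (rapid_opp _ H1) (rapid_opp _ H2)).
Qed.

Lemma CDerive_n_opp B k : crapid B ->
  CDerive_n (fun y => B (- y)) k 0 = (RtoC ((- 1) ^ k) * CDerive_n B k 0)%C.
Proof.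
  intros [H1 H2].
  assert (E : forall b, rapid b ->
    Derive_n (fun y => b (- y)) k 0 = (- 1) ^ k * Derive_n b k 0).
  { intros b Hb. rewrite Derive_n_comp_opp, Ropp_0; trivial.
    apply filter_forall. intros z j _. apply Hb. }
  unfold CDerive_n. rewrite (E _ H1), (E _ H2).
  unfold RtoC, Cmult; cbn. f_equal; ring.
Qed.

Lemma bO_bigO_infty e F : bO e (fun lam => Cmod (F lam)) ->
  bigO_infty F (fun lam => Rpower lam e).
Proof.
  intros [C H]. exists C, 1. intros lam Hlam.
  rewrite (Rabs_pos_eq (Rpower _ _)) by apply Rlt_le, Rpower_pos.
  apply Rle_trans with (1 := Rle_abs _), H. lra.
Qed.

Lemma sign_mult_pow s m : s = 1 \/ s = - 1 -> s * (- 1) ^ m = 1 \/ s * (- 1) ^ m = - 1.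
Proof.
  intros Hs. induction m as [|m IH]; [rewrite Rmult_1_r; trivial|].
  simpl. replace (s * (- 1 * (- 1) ^ m)) with (- (s * (- 1) ^ m)) by ring. lra.
Qed.

Lemma phase_root_pow p a x : 0 < p -> 0 < one_plus_series a x ->
  rpow x p * one_plus_series a x = rpow (phase_root p a x) p.
Proof.
  intros Hp Ha. unfold phase_root. rewrite (rpow_pos (one_plus_series a x)) by trivial.
  assert (P := Rpower_pos (one_plus_series a x) (/ p)).
  destruct (Rlt_dec 0 x) as [h|h].
  - rewrite !rpow_pos by (trivial; nra). rewrite <- Rpower_mult_distr by trivial.
    rewrite Rpower_mult, Rinv_l, Rpower_1; trivial. lra.
  - rewrite !rpow_nonpos by nra. ring.
Qed.

Lemma phase_root_pow_nat m a x : (1 <= m)%nat -> 0 < one_plus_series a x ->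
  x ^ m * one_plus_series a x = phase_root (INR m) a x ^ m.
Proof.
  intros Hm Ha. unfold phase_root. rewrite rpow_pos by trivial.
  rewrite Rpow_mult_distr, <- (Rpower_pow m (Rpower _ _)) by apply Rpower_pos.
  assert (INR m <> 0) by (apply not_0_INR; lia).
  now rewrite Rpower_mult, Rinv_l, Rpower_1.
Qed.

(** * Reduction of the phase integrals to the model phase *)

Section Phase.

Context (p : R) (a : nat -> R) (r r1 : R) (Hp : 0 < p) (Hr : 0 < r < r1).

Let f := phase_root p a.
Let g := local_inverse f r.

Context (Hf : forall n, Cn n (ball0 r1) f)
  (Hpos : forall x, ball0 r1 x -> 0 < Derive f x)
  (Hsum : forall x, ball0 r x -> 0 < one_plus_series a x)
  (u : R -> C) (Hu : test_function u) (Hsupp : included (supp u) (ball0 r)).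

Let B (y : R) : C := (u (g y) * RtoC (Derive g y))%C.

Lemma phase_root_0 : f 0 = 0.
Proof. unfold f, phase_root. ring. Qed.

Lemma amplitude_data : exists c, 0 < c < r /\ crapid B /\
  (forall x, x < - c \/ c < x -> u x = 0%C) /\
  (forall y, y < f (- c) \/ f c < y -> B y = 0%C) /\ f (- c) < 0 < f c.
Proof.
  destruct (supp_in_smaller_ball u r) as (d & Hd & Sd); [lra|trivial|].
  assert (I : forall x y, - r1 < x -> x < y -> y < r1 -> f x < f y).
  { intros x y h1 h2 h3. apply (inv_increasing f r1 Hf Hpos); unfold ball0; lra. }
  exists d. split; [trivial|]. split; [|split; [|split]].
  - exact (crapid_amplitude f r r1 Hr Hf Hpos u d Hu Hd Sd).
  - intros x Hx. apply NNPP. intros N. apply Sd in N. lra.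
  - intros y Hy. apply NNPP. intros N.
    assert (K : f (- d) <= y <= f d); [|lra].
    apply (inverse_support f r r1 Hr Hf Hpos (fun x => u x <> 0%C) d Hd Sd).
    intros E. apply N. unfold B, g. rewrite E. apply Cmult_0_l.
  - rewrite <- phase_root_0. split; apply I; lra.
Qed.

Lemma CInt_half_phase s lam : s = 1 \/ s = - 1 ->
  CInt_half (fun x => (expi (s * lam * (rpow x p * one_plus_series a x)) * u x)%C)
  = half_line s p 0 B lam.
Proof.
  intros Hs. destruct amplitude_data as (c & Hc & HB & Zu & ZB & F).
  destruct (amplitude_change_of_variables f r r1 Hr Hf Hpos
    (fun t => s * (lam * rpow t p)) u 0 c) as (l & Hx & Hy); try lra; [|apply Hu|].
  { intros x. apply (continuous_scal_r (V := R_NormedModule)).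
    apply (continuous_scal_r (V := R_NormedModule)). now apply rpow_continuous. }
  rewrite phase_root_0 in Hy.
  assert (K := is_RInt_half_line s p B lam (f c) Hs Hp HB ltac:(lra) (fun y h => ZB y (or_intror h))).
  (* Both sides are the integral of the same function over [0, f c]. *)
  replace (half_line s p 0 B lam) with l.
  2: { rewrite <- (is_RInt_unique (V := C_R_CompleteNormedModule) _ _ _ _ Hy).
       apply (is_RInt_unique (V := C_R_CompleteNormedModule) _ _ _ _ K). }
  apply CInt_half_unique. apply is_RInt_gen_compact_half with c; [lra| |].
  - intros x Hx'. rewrite Zu by tauto. apply Cmult_0_r.
  - apply is_RInt_ext with (2 := Hx). intros x Hx'.
    rewrite Rmin_left, Rmax_right in Hx' by lra.
    rewrite phase_root_pow by (trivial; apply Hsum; unfold ball0; lra).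
    now rewrite Rmult_assoc.
Qed.

Lemma CInt_line_phase m s lam : (1 <= m)%nat -> p = INR m -> s = 1 \/ s = - 1 ->
  CInt_line (fun x => (expi (s * lam * (x ^ m * one_plus_series a x)%R) * u x)%C)
  = (half_line s p 0 B lam + half_line (s * (- 1) ^ m) p 0 (fun y => B (- y)) lam)%C.
Proof.
  intros Hm Hpm Hs. destruct amplitude_data as (c & Hc & HB & Zu & ZB & F).
  destruct (amplitude_change_of_variables f r r1 Hr Hf Hpos
    (fun t => s * (lam * t ^ m)) u (- c) c) as (l & Hx & Hy); try lra; [|apply Hu|].
  { intros x. apply (continuous_scal_r (V := R_NormedModule)).
    apply (continuous_scal_r (V := R_NormedModule)). apply pow_continuous. }
  assert (Hs' : s * (- 1) ^ m = 1 \/ s * (- 1) ^ m = - 1) by now apply sign_mult_pow.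
  assert (K1 := is_RInt_half_line s p B lam (f c) Hs Hp HB ltac:(lra)
    (fun y h => ZB y (or_intror h))).
  assert (ZB' : forall y, - f (- c) < y -> B (- y) = 0%C) by (intros y h; apply ZB; lra).
  assert (K2 := is_RInt_half_line (s * (- 1) ^ m) p _ lam (- f (- c)) Hs' Hp
    (crapid_opp B HB) ltac:(lra) ZB').
  set (l1 := half_line s p 0 B lam) in *.
  set (l2 := half_line (s * (- 1) ^ m) p 0 (fun y => B (- y)) lam) in *.
  set (G := fun y => (expi (s * (lam * y ^ m)) * B y)%C : C_R_CompleteNormedModule).
  assert (G1 : is_RInt G 0 (f c) l1).
  { apply is_RInt_ext with (2 := K1). intros y Hy'. rewrite Rmin_left in Hy' by lra.
    unfold G. rewrite rpow_pos, Hpm, Rpower_pow by lra. reflexivity. }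
  (* Under y -> -y the power gives (-1)^m, which goes into the sign s, while the minus sign of dy
     cancels the reversed orientation; so the two half-lines add up. *)
  assert (G2 : is_RInt G (f (- c)) 0 l2).
  { assert (K3 : is_RInt (fun y => G (- y)) (- f (- c)) (- 0) (opp l2)).
    { rewrite Ropp_0. apply (is_RInt_swap (V := C_R_NormedModule)).
      apply is_RInt_ext with (2 := K2). intros y Hy'. rewrite Rmin_left in Hy' by lra.
      unfold G. rewrite rpow_pos, Hpm, Rpower_pow by lra.
      replace (- y) with (- 1 * y) at 2 by ring. rewrite Rpow_mult_distr.
      replace (s * (- 1) ^ m * (lam * y ^ m)) with (s * (lam * ((- 1) ^ m * y ^ m))) by ring.
      reflexivity. }
    apply (is_RInt_comp_opp (V := C_R_NormedModule)) in K3.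
    apply (is_RInt_opp (V := C_R_NormedModule)) in K3.
    assert (OO : forall z : C_R_NormedModule, opp (opp z) = z) by (intros z; apply opp_opp).
    refine (eq_rect _ (is_RInt G (f (- c)) 0) (is_RInt_ext _ _ _ _ _ _ K3) _ (OO l2)).
    intros y _. rewrite Ropp_involutive. apply OO. }
  assert (G12 := is_RInt_Chasles _ _ _ _ _ _ G2 G1).
  replace (l1 + l2)%C with l.
  2: { rewrite <- (is_RInt_unique (V := C_R_CompleteNormedModule) _ _ _ _ Hy).
       rewrite Cplus_comm.
       apply (is_RInt_unique (V := C_R_CompleteNormedModule) _ _ _ _ G12). }
  apply CInt_line_unique. apply is_RInt_gen_compact_line with (- c) c; [lra| |].
  - intros x Hx'. rewrite Zu by tauto. apply Cmult_0_r.
  - apply is_RInt_ext with (2 := Hx). intros x Hx'.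
    rewrite Rmin_left, Rmax_right in Hx' by lra.
    rewrite phase_root_pow_nat by (trivial; apply Hsum; unfold ball0; lra).
    rewrite <- Hpm. now rewrite Rmult_assoc.
Qed.

Lemma half_phase_expansion s N : s = 1 \/ s = - 1 -> (1 <= N)%nat ->
  bO (- ((INR N + 1) / p)) (fun lam =>
    Cmod (CInt_half (fun x => (expi (s * lam * (rpow x p * one_plus_series a x)) * u x)%C)
      - sum_n (half_line_term s p B lam) (pred N))).
Proof.
  intros Hs HN. destruct amplitude_data as (c & _ & HB & _).
  apply bO_ext with (2 := half_line_expansion s p B N Hs Hp HB HN).
  intros lam _. now rewrite CInt_half_phase.
Qed.

Lemma line_phase_expansion m s N : (1 <= m)%nat -> p = INR m ->
  s = 1 \/ s = - 1 -> (1 <= N)%nat ->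
  bO (- ((INR N + 1) / p)) (fun lam =>
    Cmod (CInt_line (fun x => (expi (s * lam * (x ^ m * one_plus_series a x)%R) * u x)%C)
      - sum_n (fun k => coef_line s m k / RtoC (INR (fact k)) * CDerive_n B k 0
                * RtoC (Rpower lam (- ((INR k + 1) / p)))) (pred N))%C).
Proof.
  intros Hm Hpm Hs HN. destruct amplitude_data as (c & _ & HB & _).
  assert (Hs' : s * (- 1) ^ m = 1 \/ s * (- 1) ^ m = - 1) by now apply sign_mult_pow.
  destruct (bO_plus _ _ _ (half_line_expansion s p B N Hs Hp HB HN)
    (half_line_expansion _ p _ N Hs' Hp (crapid_opp B HB) HN)) as [M HM].
  exists M. intros lam Hlam. apply Rle_trans with (2 := HM lam Hlam).
  rewrite CInt_line_phase by trivial.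
  rewrite (Rabs_pos_eq (Cmod _)) by apply Cmod_ge_0.
  apply Rle_trans with (2 := Rle_abs _).
  apply Rle_trans with (2 := Cmod_triangle _ _).
  apply Req_le. f_equal.
  rewrite (sum_n_ext _ (fun k => plus (half_line_term s p B lam k)
    (half_line_term (s * (- 1) ^ m) p (fun y => B (- y)) lam k))).
  - rewrite sum_n_plus. change plus with Cplus. ring.
  (* The k-th derivative of B(-y) at 0 carries the factor (-1)^k that appears in [coef_line]. *)
  - intros k. unfold half_line_term, coef_line. rewrite CDerive_n_opp by trivial.
    rewrite <- Hpm. change plus with Cplus. unfold Cdiv.
    match goal with |- ?x = ?y => change (@eq C x y) end. ring.
Qed.

End Phase.

Theorem theorem6p3 :
  forall (p : R) (a : nat -> R) (l0 : R),
    0 < p ->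
    is_lub (root_set a) l0 ->
    (forall x : R, in_radius l0 x ->
       ex_series (fun j => a (S j) * x ^ S j) /\ 0 < one_plus_series a x) /\
    exists (U V : R -> Prop) (Phi : R -> R),
      connected_open_nbhd0 U /\ included U (in_radius l0) /\
      connected_open_nbhd0 V /\ included V (in_radius l0) /\
      diffeomorphism V U Phi /\
      (forall y : R, V y -> phase_root p a (Phi y) = y) /\
      maps_onto Phi (fun y => V y /\ 0 <= y) (fun x => U x /\ 0 <= x) /\
      maps_onto Phi (fun y => V y /\ y <= 0) (fun x => U x /\ x <= 0) /\
      forall u : R -> C, test_function u -> included (supp u) U ->
        (forall (s : R) (N : nat), s = 1 \/ s = -1 -> (1 <= N)%nat ->
           bigO_infty
             (fun lam =>
                (CInt_half (fun x =>
                   expi (s * lam * (rpow x p * one_plus_series a x)) * u x)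
                 - sum_n (fun k =>
                     Itilde s p k / RtoC (INR (fact k)) * amp_deriv0 u Phi k
                     * RtoC (Rpower lam (- ((INR k + 1) / p)))) (pred N))%C)
             (fun lam =>
                Rpower lam (- ((INR N + 1 - (p - IZR (Int_part p))) / p))))
        /\
        (forall m : nat, (1 <= m)%nat -> p = INR m ->
         forall (s : R) (N : nat), s = 1 \/ s = -1 -> (1 <= N)%nat ->
           bigO_infty
             (fun lam =>
                (CInt_line (fun x =>
                   expi (s * lam * (x ^ m * one_plus_series a x)%R) * u x)
                 - sum_n (fun k =>
                     coef_line s m k / RtoC (INR (fact k)) * amp_deriv0 u Phi k
                     * RtoC (Rpower lam (- ((INR k + 1) / INR m)))) (pred N))%C)
             (fun lam => Rpower lam (- ((INR N + 1) / INR m)))).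
Proof.
  intros p a l0 Hp Hl.
  split; [intros x; now apply series_in_radius|].
  destruct (phase_root_local p a l0 Hp Hl) as (r1 & Hr1 & Hf & H).
  (* Halving the radius keeps the closed interval [-r, r] inside the ball where f is smooth and
     increasing. *)
  set (f := phase_root p a) in *. set (r := r1 / 2).
  assert (Hr : 0 < r < r1) by (unfold r; lra).
  assert (Hpos : forall x, ball0 r1 x -> 0 < Derive f x) by apply H.
  assert (Bs : forall x, ball0 r x -> ball0 r1 x) by (unfold ball0; intros; lra).
  assert (Hsum : forall x, ball0 r x -> 0 < one_plus_series a x).
  { intros x Hx. apply (series_in_radius a l0 x Hl), H, Bs, Hx. }
  assert (f0 : f 0 = 0) by (unfold f, phase_root; ring).
  assert (OB : forall c d x, c < x < d -> neighbourhood (fun y => c < y < d) x).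
  { intros c d x Hx. destruct (open_Ioo c d x Hx) as [e He]. exists e. exact He. }
  assert (V0 : f (- r) < 0 < f r).
  { rewrite <- f0. split; apply (inv_increasing f r1 Hf Hpos); unfold ball0; lra. }
  set (g := local_inverse f r).
  assert (GR : forall y, f (- r) < y < f r -> - r < g y < r /\ f (g y) = y)
    by exact (inv_right f r r1 Hr Hf Hpos).
  assert (GL : forall x, - r < x < r -> f (- r) < f x < f r /\ g (f x) = x)
    by exact (inv_left f r r1 Hr Hf Hpos).
  (* f preserves signs, being increasing with f(0) = 0; this yields the correspondence of the two
     half-neighbourhoods. *)
  assert (Sg : forall x, ball0 r x -> (0 < f x <-> 0 < x) /\ (f x < 0 <-> x < 0)).
  { intros x Hx. rewrite <- f0 at 1 3.
    rewrite !(inv_increasing_iff f r1 Hf Hpos); try (now apply Bs); unfold ball0; [tauto|lra|lra]. }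
  (* V is the image of U = (-r, r) under f, in general a different interval, and Phi is the inverse
     of f. *)
  exists (ball0 r), (fun y => f (- r) < y < f r), g.
  split; [|split; [|split; [|split; [|split; [|split; [|split; [|split]]]]]]].
  - split; [|split].
    + intros x y z; unfold ball0; lra.
    + intros x Hx. now apply OB.
    + unfold ball0; lra.
  - intros x Hx. now apply H, Bs.
  - split; [|split; trivial].
    + intros x y z; lra.
    + intros x Hx. now apply OB.
  - intros y Hy. destruct (GR y Hy) as [Hg <-]. apply H. now apply Bs.
  - split; [|split].
    + intros n y Hy. apply (Cn_ex_derive_n n (fun y => f (- r) < y < f r)); trivial.
      * apply open_Ioo.
      * exact (inv_Cn f r r1 Hr Hf Hpos n).
    + intros y Hy. now apply GR.
    + exists f. split; [|split; [|split]].
      * intros n x Hx. apply (Cn_ex_derive_n n (ball0 r1)); [apply open_ball0|apply Hf|now apply Bs].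
      * intros x Hx. now apply GL.
      * intros y Hy. now apply GR.
      * intros x Hx. now apply GL.
  - intros y Hy. now apply GR.
  - intros x. split.
    + intros [Hx Hx0]. exists (f x). destruct (GL x Hx) as [G1 G2]. split; [|trivial].
      split; [trivial|]. destruct (Sg x Hx) as [_ S2]. apply Rnot_lt_le. intros N. apply S2 in N. lra.
    + intros (y & [Hy Hy0] & <-). destruct (GR y Hy) as [G1 G2]. split; [trivial|].
      destruct (Sg _ G1) as [_ S2]. apply Rnot_lt_le. intros N. apply S2 in N. lra.
  - intros x. split.
    + intros [Hx Hx0]. exists (f x). destruct (GL x Hx) as [G1 G2]. split; [|trivial].
      split; [trivial|]. destruct (Sg x Hx) as [S1 _]. apply Rnot_lt_le. intros N. apply S1 in N. lra.
    + intros (y & [Hy Hy0] & <-). destruct (GR y Hy) as [G1 G2]. split; [trivial|].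
      destruct (Sg _ G1) as [S1 _]. apply Rnot_lt_le. intros N. apply S1 in N. lra.
  - intros u Hu Hsupp. split.
    + intros s N Hs HN. apply bO_bigO_infty.
      (* The remainder obtained is O(lam^(-(N+1)/p)) for every real p > 0; the stated exponent is no
         smaller because p - [p] >= 0. *)
      apply bO_weaken with (- ((INR N + 1) / p)).
      * apply Ropp_le_contravar. apply Rmult_le_compat_r; [now apply Rlt_le, Rinv_0_lt_compat|].
        generalize (base_Int_part p). lra.
      * exact (half_phase_expansion p a r r1 Hp Hr Hf Hpos Hsum u Hu Hsupp s N Hs HN).
    + intros m Hm Hpm s N Hs HN. apply bO_bigO_infty. rewrite <- Hpm.
      exact (line_phase_expansion p a r r1 Hp Hr Hf Hpos Hsum u Hu Hsupp m s N Hm Hpm Hs HN).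
Qed.
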